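(* For every $\varepsilon > 0$ and every integer $k \ge 2$ there is an $\eta > 0$ such that for all sufficiently large $n$ the following holds. If $\mathcal{F}$ is a family of subsets of $[n]$ of size $m = |\mathcal{F}| \ge (1-\eta) k 2^{n/k}$ with at least $\left(1 - \frac{1+\eta}{k}\right)\binom{m}{2}$ comparable pairs, then all but at most $\varepsilon m$ sets of $\mathcal{F}$ are contained in a tower of $k$ cubes of dimension $n/k$.
   Context: A comparable pair in $\mathcal{F}$ is an unordered pair of distinct sets $A,B\in\mathcal{F}$ with $A\subseteq B$ or $B \subseteq A$. For sets $X \subseteq Y \subseteq [n]$, the subcube between them is $\{F \subseteq [n] : X \subseteq F \subseteq Y\}$, of dimension $|Y|-|X|$. A tower of $k$ cubes of dimension $n/k$ is a family of the form $\bigcup_{i=1}^k \{F \subseteq [n]: X_{i-1} \subseteq F \subseteq X_i\}$ where $\emptyset = X_0 \subseteq X_1 \subseteq \dots \subseteq X_k = [n]$ is a chain with $|X_i| - |X_{i-1}| = n/k$ for each $i$. *)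

(* Defs.v *)
From mathcomp Require Import all_boot all_order all_algebra.
From mathcomp Require Import all_classical all_reals all_analysis.

Set Implicit Arguments.
Unset Strict Implicit.
Unset Printing Implicit Defensive.

Import Order.TTheory GRing.Theory Num.Theory.

(* The ground set [n] is represented by 'I_n, and a family of subsets of [n]
   by an element of {set {set 'I_n}}. *)

(* An unordered pair of distinct sets is a two-element set {A, B} of sets, so
   each comparable pair is counted once. *)
Definition comparable_pairs (n : nat) (F : {set {set 'I_n}}) :
    {set {set {set 'I_n}}} :=
  [set P : {set {set 'I_n}} |
    [exists A in F, exists B in F,
      [&& A != B, (A \subset B) || (B \subset A) & P == [set A; B]%SET]]].

Definition subcube (n : nat) (X Y : {set 'I_n}) : {set {set 'I_n}} :=
  [set S : {set 'I_n} | (X \subset S) && (S \subset Y)].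

(* Only used when X \subset Y, where the subtraction is not truncated. *)
Definition subcube_dim (n : nat) (X Y : {set 'I_n}) : nat := #|Y| - #|X|.

(* Only the values X 0, ..., X k matter.  The dimension is required to equal the
   exact quotient n / k, so for k > 0 there is no tower unless k divides n. *)
Definition is_tower (n k : nat) (T : {set {set 'I_n}}) : Prop :=
  exists X : nat -> {set 'I_n},
    [/\ X 0 = finset.set0,
        X k = [set: 'I_n]%SET,
        forall i, i < k -> X i \subset X i.+1,
        forall i, i < k -> k * subcube_dim (X i) (X i.+1) = n
      & T = (\bigcup_(i < k) subcube (X i) (X i.+1))%SET].

(* Main.v *)
(** A family F of m >= 2^(n/k) sets has o(m^(k+1)) chains of length k + 1: otherwise, the
    union of boundedly many random members lying below a dense set of chains gives k + 1
    successive sets, each larger than the previous one by more than n/(k+1).  Hence the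
    comparability graph of F has nearly the Turan number of edges and few (k+1)-cliques,
    and by the Moon-Moser inequalities some k-clique c_1 < ... < c_k has classes V_i
    (the sets comparable with every c_j except c_i) that nearly partition F, have nearly
    equal sizes, and are such that nearly all pairs across V_i and V_j, i < j, are nested.
    For a point x let d_i(x) be the density in V_i of the sets containing x.  The d_i(x)
    are close to 0 for small i and to 1 for large i.  If no d_i(x) were intermediate,
    removing x would leave layers in a cube of dimension n - 1 with product of sizes
    about 2^n, and such layers have a positive proportion of tuples that are not chains.
    So each x has exactly one intermediate layer, the X_i = {x : d_i(x) near 1} form a
    chain, and nearly all of V_i lies between X_i and X_{i+1}.  Then 2^(k d) > 2^(n-1)
    for each dimension d = |X_{i+1}| - |X_i|; as these sum up to n, all are n/k. *)
Require Import Defs.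
From mathcomp Require Import all_boot all_order all_algebra.
From mathcomp Require Import zify ring lra.

Set Implicit Arguments.
Unset Strict Implicit.
Unset Printing Implicit Defensive.

Import Order.TTheory GRing.Theory Num.Theory.

(** * Chebyshev and power-mean inequalities for weighted sums *)

Lemma chebyshev_expn (a b t : nat) :
  a ^ t * b + b ^ t * a <= a ^ t.+1 + b ^ t.+1.
Proof.
wlog le_ab : a b / a <= b.
  by move=> H; case/orP: (leq_total a b) => /H //; rewrite addnC [leqRHS]addnC.
rewrite !expnSr.
have : a ^ t <= b ^ t by case: t => // t; rewrite leq_exp2r.
by nia.
Qed.

(** Twice the difference of the two sides is the sum over ordered pairs (i, j) of w_i w_j (a_i^t -
    a_j^t) (a_i - a_j), where no term is negative. *)
Lemma sum_chebyshev (I : finType) (P : pred I) (w a : I -> nat) (t : nat) :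
  (\sum_(i | P i) w i * a i ^ t) * (\sum_(i | P i) w i * a i) <=
  (\sum_(i | P i) w i * a i ^ t.+1) * (\sum_(i | P i) w i).
Proof.
rewrite -(leq_pmul2l (isT : 0 < 2)) !mul2n -!addnn.
rewrite [X in X + _ <= _]big_distrlr [X in _ + X <= _]big_distrlr /=.
rewrite [X in _ + X <= _]exchange_big.
rewrite [X in _ <= X + _]big_distrlr [X in _ <= _ + X]big_distrlr /=.
rewrite [X in _ <= _ + X]exchange_big -!big_split /=.
apply: leq_sum => i _; rewrite -!big_split /=; apply: leq_sum => j _.
have := leq_mul (leqnn (w i * w j)) (chebyshev_expn (a i) (a j) t).
by lia.
Qed.

Lemma sum_power_mean (I : finType) (P : pred I) (w a : I -> nat) (t : nat) :
  (\sum_(i | P i) w i * a i) ^ t.+1 <=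
  (\sum_(i | P i) w i * a i ^ t.+1) * (\sum_(i | P i) w i) ^ t.
Proof.
elim: t => [|t IHt].
  by rewrite !expn1 expn0 muln1; under [leqRHS]eq_bigr do rewrite expn1.
rewrite expnSr; apply: leq_trans (leq_mul IHt (leqnn _)) _.
have := leq_mul (sum_chebyshev P w a t.+1) (leqnn ((\sum_(i | P i) w i) ^ t)).
by rewrite [X in _ -> _ <= _ * X]expnS mulnA [X in _ -> X <= _]mulnAC.
Qed.

Lemma leq_pexp2r (m n e : nat) : m <= n -> m ^ e <= n ^ e.
Proof. by case: e => // e; rewrite leq_exp2r. Qed.

Lemma card_bigcup_le (I T : finType) (P : pred I) (A : I -> {set T}) :
  #|\bigcup_(i | P i) A i| <= \sum_(i | P i) #|A i|.
Proof.
elim/big_ind2: _ => [|A1 n1 A2 n2 le1 le2|i _] //; first by rewrite cards0.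
by rewrite cardsU (leq_trans (leq_subr _ _)) // leq_add.
Qed.

(** * Families of size 2^(n/k) have few chains of length k + 1 *)

Section FewChains.
Variable T : finType.
Implicit Types (U W A B : {set T}) (F : {set {set T}}).

(* Chains are weak: repetitions are counted. *)
Fixpoint nchains F (j : nat) U : nat :=
  if j is j'.+1 then \sum_(A in F | U \subset A) nchains F j' A else 1.

Lemma nchainsS F j U :
  nchains F j.+1 U = \sum_(A in F | U \subset A) nchains F j A.
Proof. by []. Qed.

Lemma nchains_le F j U : nchains F j U <= #|F| ^ j.
Proof.
elim: j U => [//|j IHj] U; rewrite nchainsS expnS -sum_nat_const.
rewrite big_mkcondr /=; apply: leq_sum => A _; case: ifP => // _; exact: IHj.
Qed.

Definition between F U W : {set {set T}} := 
  [set A in F | (U \subset A) && (A \subset W)].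

Lemma card_between F U W : #|between F U W| <= 2 ^ (#|W| - #|U|).
Proof.
have [sUW|nUW] := boolP (U \subset W); last first.
  rewrite (_ : between F U W = set0) ?cards0 //.
  apply/setP=> A; rewrite !inE; apply/negP=> /and3P[_ UA AW].
  by rewrite (subset_trans UA AW) in nUW.
rewrite -(cardsDS sUW) -card_powerset -(card_in_imset (f := fun A => A :\: U) (D := between F U W)).
  apply/subset_leq_card/subsetP=> _ /imsetP[A A_in ->].
  by move: A_in; rewrite !inE => /and3P[_ _ sAW]; rewrite setSD.
move=> A B; rewrite !inE => /and3P[_ UA _] /and3P[_ UB _] eqAB.
by rewrite -(setID A U) -(setID B U) eqAB (setIidPr UA) (setIidPr UB).
Qed.

(* Swapping the two lowest members of a chain. *)
Lemma nchainsSS F j U :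
  nchains F j.+2 U =
  \sum_(B in F | U \subset B) nchains F j B * #|between F U B|.
Proof.
rewrite nchainsS; under eq_bigr => A do rewrite nchainsS.
rewrite (exchange_big_dep (fun B => (B \in F) && (U \subset B))) /=; last first.
  by move=> A B /andP[_ UA] /andP[-> AB]; rewrite (subset_trans UA AB).
apply: eq_bigr => B /andP[BF UB]; rewrite sum_nat_const mulnC; congr (_ * _).
by apply: eq_card => A; rewrite !inE BF andbA.
Qed.

End FewChains.

Section Supersaturation.
Variable T : finType.
Implicit Types (U W A B : {set T}) (F : {set {set T}}).

Definition above F U t : {set {ffun 'I_t -> {set T}}} :=
  [set g in ffun_on (mem [set A in F | U \subset A])].

Definition joinf U t (g : {ffun 'I_t -> {set T}}) := U :|: \bigcup_i g i.

Lemma card_above F U t : #|above F U t| = #|[set A in F | U \subset A]| ^ t.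
Proof. by rewrite cardsE card_ffun_on card_ord. Qed.

Lemma card_above_between F U W t :
  #|[set g in above F U t | joinf U g \subset W]| <= #|between F U W| ^ t.
Proof.
rewrite -[X in _ ^ X]card_ord -card_ffun_on; apply/subset_leq_card/subsetP=> g.
rewrite !inE subUset => /andP[/ffun_onP gF /andP[UW /bigcupsP gW]].
by apply/ffun_onP=> i; have := gF i; rewrite !inE gW // andbT.
Qed.

Lemma card_between_above F U W t : U \subset W ->
  #|[set g in above F U t | joinf U g \subset W]| = #|between F U W| ^ t.
Proof.
move=> UW; apply/eqP; rewrite eqn_leq card_above_between /=.
rewrite -[X in _ ^ X]card_ord -card_ffun_on; apply/subset_leq_card/subsetP=> g.
move/ffun_onP=> gI; rewrite !inE subUset UW /=; apply/andP; split.
  by apply/ffun_onP=> i; have := gI i; rewrite !inE => /and3P[-> ->].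
by apply/bigcupsP=> i _; have := gI i; rewrite inE => /and3P[].
Qed.

Lemma sum_nchains_joinf F j U t :
  \sum_(g in above F U t) nchains F j.+1 (joinf U g) =
  \sum_(B in F | U \subset B) nchains F j B * #|between F U B| ^ t.
Proof.
under eq_bigr do rewrite nchainsS.
rewrite (exchange_big_dep (fun B => (B \in F) && (U \subset B))) /=; last first.
  move=> g B _ /andP[-> gB]; apply: subset_trans gB; exact: subsetUl.
apply: eq_bigr => B /andP[BF UB]; rewrite -(card_between_above _ _ UB).
rewrite sum_nat_const mulnC; congr (_ * _).
by apply: eq_card => g; rewrite unfold_in !inE BF.
Qed.

(** Power mean over [B] of the values [#|between F U B|] with weights [nchains F j B], whose sum
    [nchains F j.+1 U] is at most [#|F| ^ j.+1]. *)
Lemma sum_nchains_joinf_ge F j U t :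
  nchains F j.+2 U ^ t.+1 <=
  (\sum_(g in above F U t.+1) nchains F j.+1 (joinf U g)) * #|F| ^ (j.+1 * t).
Proof.
rewrite nchainsSS sum_nchains_joinf.
apply: leq_trans (sum_power_mean _ _ _ _) _.
rewrite leq_mul2l expnM; apply/orP; right; apply/leq_pexp2r.
exact: (nchains_le F j.+1 U).
Qed.

(** There are at most 2^n joins [W], and for each of them the [t] sets of the tuple lie in a cube of
    dimension less than [d]. *)
Lemma card_small_join F U t d :
  #|[set g in above F U t | #|joinf U g| < #|U| + d]| <= 2 ^ #|T| * (2 ^ d) ^ t.
Proof.
have -> : [set g in above F U t | #|joinf U g| < #|U| + d] =
    \bigcup_(W in [set W : {set T} | #|W| < #|U| + d])
      [set g in above F U t | joinf U g == W].
  apply/setP=> g; rewrite !inE; apply/idP/bigcupP.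
    by case/andP=> gF gU; exists (joinf U g); rewrite !inE ?gU ?gF /=.
  by case=> W; rewrite !inE => WU /andP[-> /eqP->].
apply: leq_trans (card_bigcup_le _ _) _.
rewrite -cardsT -card_powerset powersetT -sum_nat_const.
rewrite big_mkcond [leqRHS]big_mkcond /=.
apply: leq_sum => W _; rewrite !inE /=; case: ifP => // ltW.
apply: (@leq_trans (#|between F U W| ^ t)).
- apply: leq_trans (card_above_between F U W t).
  by apply/subset_leq_card/subsetP=> g; rewrite !inE => /andP[-> /eqP->] /=.
- apply/leq_pexp2r; apply: leq_trans (card_between F U W) _.
  by rewrite leq_exp2l //; lia.
Qed.
End Supersaturation.

Lemma nchains1 (T : finType) (F : {set {set T}}) U :
  nchains F 1 U = #|between F U setT|.
Proof.
by rewrite nchainsS sum1_card -cardsE; apply: eq_card => A; rewrite !inE subsetT andbT.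
Qed.

Lemma leq_expn2 (M e : nat) : M ^ e <= 2 ^ (M * e).
Proof. by rewrite expnM leq_pexp2r // ltnW // ltn_expl. Qed.

(** A larger [U] would leave above it a cube with at most 2^(n/(k+1)) sets, and [M] times this is
    below 2^(n/k) once n > M k (k+1). *)
Lemma few_chains_base (T : finType) (F : {set {set T}}) k M U :
  M * (k * k.+1) < #|T| -> 2 ^ #|T| <= #|F| ^ k ->
  #|F| <= M * nchains F 1 U -> #|U| + (#|T| %/ k.+1).+1 <= #|T|.
Proof.
move=> ltn geF leF; rewrite leqNgt; apply/negP => ltU.
have leU : #|T| - #|U| <= #|T| %/ k.+1.
  by move: ltU; move: (_ %/ _) => q; lia.
have leF2 : #|F| <= M * 2 ^ (#|T| %/ k.+1).
  apply: leq_trans leF _; rewrite leq_mul2l nchains1; apply/orP; right.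
  by apply: leq_trans (card_between _ _ _) _; rewrite cardsT leq_exp2l.
have : 2 ^ (#|T| * k.+1) <= 2 ^ (M * (k * k.+1)) * 2 ^ (#|T| * k).
  rewrite [X in X <= _]expnM; apply: leq_trans (leq_pexp2r k.+1 geF) _.
  rewrite -expnM; apply: leq_trans (leq_pexp2r (k * k.+1) leF2) _.
  rewrite expnMn -expnM leq_mul ?leq_expn2 // leq_exp2l //.
  by have := leq_divM #|T| k.+1; nia.
by rewrite -expnD leq_exp2l //; nia.
Qed.

(* Averaging over the t + 1 sets g: most joins are larger than U by more than
   n / (k + 1), as few tuples g lie below a common small set. *)
Lemma chain_extension (T : finType) (F : {set {set T}}) k t j M U :
  0 < M -> t.+1 = 2 * (k * k.+1) -> t.+3 + M * t.+1 <= #|T| ->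
  2 ^ #|T| <= #|F| ^ k ->
  #|F| ^ j.+2 <= M * nchains F j.+2 U ->
  exists2 U' : {set T}, #|U| + (#|T| %/ k.+1).+1 <= #|U'| &
    #|F| ^ j.+1 <= 2 * M ^ t.+1 * nchains F j.+1 U'.
Proof.
move=> M0 tk leT geF leF.
have k0 : 0 < k by rewrite lt0n; apply/eqP=> k0; move: tk; rewrite k0.
set m := #|F| in geF leF *; set d := (_ %/ _).+1.
set L := 2 * M ^ t.+1; have m0 : 0 < m.
  rewrite lt0n; apply: contraTneq geF => ->.
  by rewrite exp0n // leqn0 expn_eq0.
(* The right side is at least 2^(2n(k+1)), while d (t+1) is at most 2kn + t + 1. The exponents thus
   differ by n up to constants, which [leT] absorbs. *)
have few_bad : L * (2 ^ #|T| * (2 ^ d) ^ t.+1) < m ^ t.+1.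
  have -> : m ^ t.+1 = (m ^ k) ^ (2 * k.+1) by rewrite -expnM tk mulnCA mulnA.
  apply: leq_trans (leq_pexp2r _ geF); rewrite -expnM.
  apply: (@leq_ltn_trans (2 ^ ((M * t.+1).+1 + (#|T| + d * t.+1)))).
    rewrite [X in _ <= X]expnD [X in _ <= _ * X]expnD [X in _ <= X * _]expnS.
    by rewrite !leq_mul ?leq_expn2.
  rewrite -expnM ltn_exp2l //; have := leq_divM #|T| k.+1; rewrite /d.
  by move: (_ %/ _) => q; rewrite tk in leT *; nia.
have [/exists_inP[g gF /andP[Ug leg]]|/exists_inPn nex] :=
  boolP [exists g in above F U t.+1,
    (#|U| + d <= #|joinf U g|) && (m ^ j.+1 <= L * nchains F j.+1 (joinf U g))].
  by exists (joinf U g).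
(* Now no tuple qualifies: those with a large join contribute less than m^(j+1) each to L S, and
   those with a small join are negligible, so L S < 2 m^(t+1) m^(j+1). The power mean bound gives
   the reverse inequality, by the choice L = 2 M^(t+1). *)
set S := \sum_(g in above F U t.+1) nchains F j.+1 (joinf U g).
set bad := [set g in above F U t.+1 | #|joinf U g| < #|U| + d].
have leS : L * S <= m ^ t.+1 * m ^ j.+1 + #|bad| * (L * m ^ j.+1).
  apply: (@leq_trans (\sum_(g in above F U t.+1) m ^ j.+1 +
                      \sum_(g in bad) L * m ^ j.+1)); last first.
    rewrite !sum_nat_const leq_add2r leq_mul2r card_above leq_pexp2r ?orbT //.
    by apply/subset_leq_card/subsetP=> A; rewrite inE => /andP[].
  rewrite big_distrr /= [X in _ <= _ + X]big_mkcond [X in _ <= _ + X]/=.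
  rewrite [X in _ <= _ + X](bigID (mem (above F U t.+1))) /= addnA.
  apply: leq_trans (leq_addr _ _); rewrite -big_split /=.
  apply: leq_sum => g gF; have := nex g gF; rewrite inE gF /= negb_and -!ltnNge.
  case: ifP => [_ _|_ /= lt_g]; last by rewrite addn0 ltnW.
  apply: leq_trans (leq_addl _ _); rewrite leq_mul2l; apply/orP; right.
  exact: nchains_le.
have ltS : L * S < 2 * (m ^ t.+1 * m ^ j.+1).
  apply: leq_ltn_trans leS _; rewrite mul2n -addnn ltn_add2l mulnA ltn_mul2r.
  rewrite expn_gt0 m0 /= mulnC; apply: leq_ltn_trans few_bad.
  by rewrite leq_mul2l card_small_join orbT.
have := leq_pexp2r t.+1 leF; rewrite expnMn => /leq_trans.
move/(_ _ (leq_mul (leqnn _) (sum_nchains_joinf_ge F j U t))); rewrite -/S -/m.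
have : 0 < m ^ (j.+1 * t) by rewrite expn_gt0 m0.
have -> : (m ^ j.+2) ^ t.+1 = m ^ t.+1 * m ^ j.+1 * m ^ (j.+1 * t).
  by rewrite -expnM -!expnD; congr (_ ^ _); lia.
by move: ltS; rewrite /L; nia.
Qed.

(** Each application of [chain_extension] uses up one chain member and enlarges the base set by more
    than n/(k+1). The constant [M] becomes 2 M^(t+1), still independent of n. *)
Lemma few_chains (k j M : nat) : 0 < k -> 0 < M ->
  exists N, forall (T : finType) (F : {set {set T}}), N <= #|T| ->
    2 ^ #|T| <= #|F| ^ k -> forall U, #|F| ^ j.+1 <= M * nchains F j.+1 U ->
    #|U| + j.+1 * (#|T| %/ k.+1).+1 <= #|T|.
Proof.
move=> k0; have [t tk] : exists t, t.+1 = 2 * (k * k.+1).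
  by exists (2 * (k * k.+1)).-1; rewrite prednK // !muln_gt0 k0.
elim: j M => [|j IHj] M M0.
  exists (M * (k * k.+1)).+1 => T F leT geF U; rewrite expn1 mul1n.
  exact: few_chains_base.
have [|N HN] := IHj (2 * M ^ t.+1); first by rewrite muln_gt0 expn_gt0 M0.
exists (maxn N (t.+3 + M * t.+1)) => T F; rewrite geq_max => /andP[leN leT] geF U.
case/(chain_extension M0 tk leT geF) => U' leU' /(HN T F leN geF).
by move: leU'; move: (_ %/ _) => q; nia.
Qed.

(** Otherwise k + 1 enlargements of the empty set would need more than n points. *)
Lemma few_k1_chains (k M : nat) : 0 < k -> 0 < M ->
  exists N, forall (T : finType) (F : {set {set T}}), N <= #|T| ->
    2 ^ #|T| <= #|F| ^ k -> M * nchains F k.+1 set0 < #|F| ^ k.+1.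
Proof.
move=> k0 M0; have [N HN] := few_chains k k0 M0; exists N => T F leN geF.
rewrite ltnNge; apply/negP => /(HN T F leN geF).
by rewrite cards0 add0n leqNgt mulnC ltn_ceil.
Qed.

(** * Moon-Moser inequalities and a clique with large classes *)

Section Cliques.
Variables (V : finType) (F : {set V}) (e : rel V).
Hypotheses (e_sym : symmetric e) (e_irr : irreflexive e).
Implicit Types (C D : {set V}) (u v x y : V).

Definition is_clique C := [forall x in C, forall y in C, (x != y) ==> e x y].

Definition cliques r := [set C : {set V} | [&& C \subset F, #|C| == r & is_clique C]].

Definition ext C := [set v in F | [forall x in C, e x v]].

Lemma is_cliqueP C :
  reflect {in C &, forall x y, x != y -> e x y} (is_clique C).
Proof.
apply: (iffP forall_inP) => [H x y xC yC xy|H x xC].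
  by have /forall_inP/(_ y yC)/implyP := H x xC; apply.
by apply/forall_inP => y yC; apply/implyP; apply: H.
Qed.

Lemma mem_ext C v : (v \in ext C) = (v \in F) && [forall x in C, e x v].
Proof. by rewrite inE. Qed.

Lemma extU1 x C v : (v \in ext (x |: C)) = (v \in ext C) && e x v.
Proof.
rewrite !mem_ext -andbA; congr (_ && _).
apply/forall_inP/andP => [H|[/forall_inP H exv] y].
  split; last by apply: H; rewrite setU11.
  by apply/forall_inP=> y yC; apply: H; rewrite setU1r.
by case/setU1P=> [->|] //; apply: H.
Qed.

Lemma ext_notin C v : v \in ext C -> v \notin C.
Proof.
rewrite mem_ext => /andP[_ /forall_inP H]; apply/negP=> /H.
by rewrite e_irr.
Qed.

Lemma cliquesU1 r C x : x \notin C ->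
  (x |: C \in cliques r.+1) = (C \in cliques r) && (x \in ext C).
Proof.
move=> xC; rewrite !inE subUset sub1set cardsU1 xC add1n eqSS.
have [xF|] := boolP (x \in F); last by rewrite /= !andbF.
case: (C \subset F) (#|C| == r) => [] [] //=.
apply/is_cliqueP/andP => [H|[/is_cliqueP H /forall_inP Hx] y z].
  split; first by apply/is_cliqueP=> y z yC zC; apply: H; rewrite setU1r.
  apply/forall_inP=> y yC; apply: H; rewrite ?setU11 ?setU1r //.
  by apply: contraNneq xC => <-.
case/setU1P=> [->|yC] /setU1P[->|zC]; rewrite ?eqxx // => ne.
- by rewrite e_sym Hx.
- exact: Hx.
- exact: H.
Qed.

(* Both sides count the pairs consisting of an (r+1)-clique and one of its vertices. *)
Lemma sum_cliques_ext r (f : {set V} -> V -> nat) :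
  \sum_(C in cliques r) \sum_(x in ext C) f C x =
  \sum_(D in cliques r.+1) \sum_(x in D) f (D :\ x) x.
Proof.
rewrite !pair_big_dep /=.
rewrite (reindex_onto (fun p : {set V} * V => (p.1 :\ p.2, p.2))
  (fun p : {set V} * V => (p.2 |: p.1, p.2))) /=; last first.
  by case=> C x /= /andP[_ /ext_notin xC]; rewrite setU1K.
apply: eq_bigl => -[D x] /=; rewrite xpair_eqE eqxx andbT.
have [xD|xD] := boolP (x \in D).
  by rewrite setD1K // eqxx !andbT -cliquesU1 ?setD1K // setD11.
rewrite andbF; apply/negP => /andP[_ /eqP eqD].
by rewrite -eqD setU11 in xD.
Qed.

Lemma sum_card_ext r :
  \sum_(C in cliques r) #|ext C| = r.+1 * #|cliques r.+1|.
Proof.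
under eq_bigr do rewrite -sum1_card.
rewrite sum_cliques_ext mulnC -sum_nat_const; apply: eq_bigr => D.
by rewrite sum1_card inE => /and3P[_ /eqP].
Qed.

Lemma sum_sqr_card_ext r :
  \sum_(C in cliques r) #|ext C| ^ 2 =
  \sum_(D in cliques r.+1) \sum_(x in D) #|ext (D :\ x)|.
Proof.
rewrite -(sum_cliques_ext r (fun C x => #|ext C|)); apply: eq_bigr => C _.
by rewrite sum_nat_const.
Qed.

(** For [x] in [C], these are the vertices whose only non-neighbour in [C] is [x]; in a clique, [x]
    itself is one of them. *)
Definition cls C x := ext (C :\ x) :\: ext C.

Lemma ext_sub C x : ext C \subset ext (C :\ x).
Proof.
apply/subsetP=> v; rewrite !mem_ext => /andP[-> /forall_inP H] /=.
by apply/forall_inP=> y /setD1P[_ /H].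
Qed.

Lemma card_ext_cls C x : #|ext (C :\ x)| = #|cls C x| + #|ext C|.
Proof. by rewrite cardsDS ?ext_sub // subnK // subset_leq_card // ext_sub. Qed.

Lemma clsP C x v : x \in C ->
  reflect [/\ v \in F, {in C, forall y, y != x -> e y v} & ~~ e x v]
          (v \in cls C x).
Proof.
move=> xC; have extC : (v \in ext C) = (v \in ext (C :\ x)) && e x v.
  by rewrite -extU1 setD1K.
rewrite [v \in cls C x]inE extC (mem_ext (_ :\ _)).
apply: (iffP andP) => [[+ /andP[vF /forall_inP H]]|[vF H xv]].
  rewrite vF /=; have -> : [forall y in C :\ x, e y v] by apply/forall_inP.
  by move=> exv; split=> // y yC yx; apply: H; rewrite !inE yx.
have -> : [forall y in C :\ x, e y v].
  by apply/forall_inP=> y /setD1P[yx yC]; apply: H.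
by rewrite vF negb_and xv orbT.
Qed.

Lemma cls_inj C x y v : x \in C -> y \in C ->
  v \in cls C x -> v \in cls C y -> x = y.
Proof.
move=> xC yC /(clsP _ xC)[_ H _] /(clsP _ yC)[_ _ /negP yv].
by apply/eqP/negPn/negP=> xy; apply/yv/H; rewrite // eq_sym.
Qed.

Lemma sum_card_cls C : \sum_(x in C) #|cls C x| + #|ext C| <= #|F|.
Proof.
have sum_mem (A : {set V}) : A \subset F -> #|A| = \sum_(v in F) (v \in A).
  move=> /setIidPr {1}<-; rewrite -sum1_card big_mkcond [RHS]big_mkcond /=.
  by apply: eq_bigr => v _; rewrite inE; case: (v \in F); case: (v \in A).
rewrite -[leqRHS]sum1_card (sum_mem (ext C)); last first.
  by apply/subsetP=> v; rewrite mem_ext => /andP[].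
under eq_bigr => x xC.
  rewrite sum_mem; last by apply/subsetP=> v /(clsP _ xC)[].
  over.
rewrite exchange_big -big_split /=; apply: leq_sum => v vF.
rewrite -big_mkcondr sum1_card; have [vC|vC] := boolP (v \in ext C).
  rewrite eq_card0 // => x; rewrite unfold_in; apply/negP=> /andP[xC].
  by rewrite inE vC.
rewrite addn0; apply/card_le1_eqP => x y; rewrite !unfold_in.
move=> /andP[xC vx] /andP[yC vy]; exact: (@cls_inj C y x v yC xC vy vx).
Qed.

Lemma sum_card_ext_setD1 D : #|D| > 0 ->
  \sum_(x in D) #|ext (D :\ x)| <= #|F| + #|D|.-1 * #|ext D|.
Proof.
move=> D0; under eq_bigr do rewrite card_ext_cls.
rewrite big_split /= sum_nat_const -{1}(prednK D0) mulSn addnA leq_add2r.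
exact: sum_card_cls.
Qed.

(** Cauchy-Schwarz for [#|ext C|] over the r-cliques. The sum of squares counts the exchanges of one
    vertex in an (r+1)-clique D, and D admits at most |F| + r |ext D| of them because its classes
    are disjoint. *)
Lemma moon_moser r :
  (r.+1 * #|cliques r.+1|) ^ 2 <=
  #|cliques r| * (#|F| * #|cliques r.+1| + r * (r.+2 * #|cliques r.+2|)).
Proof.
have := sum_power_mean (mem (cliques r)) (fun=> 1) (fun C => #|ext C|) 1.
rewrite sum1_card expn1 mulnC; under eq_bigr do rewrite mul1n.
rewrite sum_card_ext => /leq_trans; apply; rewrite leq_mul2l; apply/orP; right.
under eq_bigr do rewrite mul1n.
rewrite sum_sqr_card_ext -sum_card_ext big_distrr /= mulnC -sum_nat_const.
rewrite -big_split /=; apply: leq_sum => D.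
rewrite inE => /and3P[_ /eqP cD _].
by have := @sum_card_ext_setD1 D; rewrite cD; apply.
Qed.

Lemma cliques1E : cliques 1 = [set [set x] | x in F].
Proof.
apply/setP=> C; apply/idP/imsetP.
  by rewrite inE => /and3P[CF /cards1P[x Cx] _]; move: CF; rewrite Cx sub1set; exists x.
case=> x xF ->; rewrite inE sub1set xF cards1 /=.
by apply/is_cliqueP=> y z /set1P -> /set1P ->; rewrite eqxx.
Qed.

Lemma cliques1 : #|cliques 1| = #|F|.
Proof. by rewrite cliques1E card_imset //; exact: set1_inj. Qed.

Lemma sum_edges : \sum_(u in F) \sum_(v in F) e u v = 2 * #|cliques 2|.
Proof.
rewrite -sum_card_ext cliques1E big_imset /=; last by move=> x y _ _ /set1_inj.
apply: eq_bigr => u _; rewrite -sum1_card big_mkcond [RHS]big_mkcond /=.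
apply: eq_bigr => v _; rewrite -[[set u]]setU0 extU1 mem_ext.
have -> : [forall x in set0, e x v] by apply/forall_inP=> x; rewrite inE.
by case: (v \in F); case: (e u v).
Qed.

Definition inner C x := \sum_(u in cls C x) \sum_(v in cls C x) e u v.

Lemma sum_card_cls_cliques r :
  \sum_(C in cliques r.+1) \sum_(x in C) #|cls C x| +
    r.+1 * (r.+2 * #|cliques r.+2|) = \sum_(C in cliques r) #|ext C| ^ 2.
Proof.
rewrite sum_sqr_card_ext -sum_card_ext big_distrr /= -big_split /=.
apply: eq_bigr => C; rewrite inE => /and3P[_ /eqP <- _].
by under [RHS]eq_bigr do rewrite card_ext_cls; rewrite big_split sum_nat_const.
Qed.

(** An adjacent pair inside the class of [x] completes [C :\ x] to an (r+2)-clique. Each such clique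
    with an ordered pair of its vertices arises for at most |F| choices of [x]. *)
Lemma sum_inner r :
  \sum_(C in cliques r.+1) \sum_(x in C) inner C x <=
  #|F| * (r.+1 * (r.+2 * #|cliques r.+2|)).
Proof.
pose g B := \sum_(u in ext B) #|ext (u |: B)|.
have le_g C x : inner C x <= g (C :\ x).
  have /subsetP sub : cls C x \subset ext (C :\ x) by exact: subsetDl.
  rewrite /inner /g big_mkcond [leqRHS]big_mkcond /=; apply: leq_sum => u _.
  case: ifP => // /[dup] /sub -> _; rewrite -sum1_card.
  rewrite big_mkcond [leqRHS]big_mkcond /=; apply: leq_sum => v _.
  case: ifP => // /[dup] /sub v_ext _; rewrite extU1 v_ext.
  by case: (e u v).
apply: (@leq_trans (\sum_(C in cliques r.+1) \sum_(x in C) g (C :\ x))).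
  by apply: leq_sum => C _; apply: leq_sum => x _; apply: le_g.
rewrite -(sum_cliques_ext r (fun B x => g B)).
apply: (@leq_trans (\sum_(B in cliques r) #|F| * g B)).
  apply: leq_sum => B _; rewrite sum_nat_const leq_mul2r; apply/orP; right.
  by apply/subset_leq_card/subsetP=> v; rewrite mem_ext => /andP[].
rewrite -big_distrr leq_mul2l /= (sum_cliques_ext r (fun B u => #|ext (u |: B)|)).
apply/orP; right; rewrite -sum_card_ext big_distrr; apply: leq_sum => D /=.
rewrite inE => /and3P[_ /eqP <- _]; rewrite -sum_nat_const; apply: leq_sum.
by move=> u uD; rewrite setD1K.
Qed.

End Cliques.

Local Open Scope ring_scope.

Section GoodClique.
Variables (R : realFieldType) (V : finType) (F : {set V}) (e : rel V).
Hypotheses (e_sym : symmetric e) (e_irr : irreflexive e).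
Local Notation m := (#|F|%:R : R).
Local Notation N r := (#|cliques F e r|%:R : R).

Lemma moon_moser_ring r :
  (r.+1%:R * N r.+1) ^+ 2 <= N r * (m * N r.+1 + r%:R * (r.+2%:R * N r.+2)).
Proof. by have := moon_moser F e_sym e_irr r; rewrite -(ler_nat R) natrX !(natrM, natrD). Qed.

(** The mean of |ext C| over (r+1)-cliques is (r+2) N_(r+2) / N_(r+1). As in Turan's theorem, its
    lower bound drops by z m with each vertex of the clique; Moon-Moser carries this to the next
    clique size. *)
Lemma clique_ratio (z : R) r : 0 <= z -> 0 < m -> (1 - z) * m ^+ 2 <= 2 * N 2 ->
  r.+1%:R * z <= 1 -> m * N r.+1 * (1 - r.+1%:R * z) <= r.+2%:R * N r.+2.
Proof.
move=> z0 m0 edges; elim: r => [|r IHr] rz.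
  by rewrite cliques1 // mul1r mulrC -expr2.
have {}IHr : m * N r.+1 * (1 - r.+1%:R * z) <= r.+2%:R * N r.+2.
  by apply: IHr; apply: le_trans rz; rewrite ler_wpM2r // ler_nat.
have [N0|N0] := eqVneq (N r.+2) 0.
  by rewrite N0 mulr0 mul0r mulr_ge0.
have N_gt0 : 0 < N r.+2 by rewrite lt_neqAle eq_sym N0 ler0n.
have := moon_moser_ring r.+1.
move: IHr N_gt0 rz (ler0n R r) (ler0n R #|cliques F e r.+1|) (ler0n R #|cliques F e r.+3|).
rewrite -!(natr1 r.+2) -!(natr1 r.+1) -!(natr1 r).
set a := N r.+1; set b := N r.+2; set c := N r.+3; set q := r%:R : R.
move=> IH b0 rz q0 a0 c0 MM.
have rz' : 0 <= 1 - (q + 1) * z by nra.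
have MM' : (q + 1 + 1) ^+ 2 * b ^+ 2 * (m * (1 - (q + 1) * z)) <=
  (q + 1 + 1) * b * (m * b + (q + 1) * ((q + 1 + 1 + 1) * c)).
  have h1 : 0 <= m * b + (q + 1) * ((q + 1 + 1 + 1) * c) by nra.
  have := ler_wpM2r (mulr_ge0 (ltW m0) rz') MM.
  have := ler_wpM2r h1 IH; rewrite exprMn; lra.
have pos : 0 < (q + 1 + 1) * b by rewrite mulr_gt0 //; lra.
have {}MM : (q + 1 + 1) * b * (m * (1 - (q + 1) * z)) <=
   m * b + (q + 1) * ((q + 1 + 1 + 1) * c).
  by rewrite -(ler_pM2l pos); lra.
have q1 : 0 < q + 1 by lra.
by rewrite -(ler_pM2l q1); lra.
Qed.

(** Averaging over all k-cliques, k = r + 2: the edge density makes their classes cover almost all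
    of [F] on average, and edges inside classes come from (k+1)-cliques, which are few. *)
Lemma good_clique (z eta theta : R) r : 0 <= z -> 0 <= eta -> 0 < m ->
  (1 - z) * m ^+ 2 <= 2 * N 2 ->
  z * r.+2%:R <= 1 + eta -> 2 * r.+1%:R * eta <= theta -> theta <= 1 ->
  4 * r.+3%:R ^+ 2 * (2 * r.+2%:R ^+ 2) ^+ r.+2 * N r.+3 <= theta * m ^+ r.+3 ->
  exists2 C, C \in cliques F e r.+2 &
    (m - (\sum_(x in C) #|cls F e C x|)%:R) * m + (\sum_(x in C) inner F e C x)%:R
      <= theta * m ^+ 2.
Proof.
move=> z0 eta0 m0 edges zr eta_th th1 few; set k := r.+2%:R : R.
have k_def : k = r.+1%:R + 1 by rewrite natr1.
have r1 : 1 <= r.+1%:R :> R by rewrite ler1n.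
have rz : k * (1 - r.+1%:R * z) >= 1 - r.+1%:R * eta.
  rewrite k_def in zr *; set q := r.+1%:R in zr eta_th r1 *; nra.
have rz_half : 2^-1 <= k * (1 - r.+1%:R * z) by lra.
have rz_pos : 0 < 1 - r.+1%:R * z.
  have k0 : 0 < k by rewrite ltr0n.
  by rewrite -(pmulr_rgt0 _ k0) (lt_le_trans _ rz_half) // invr_gt0 ltr0n.
(* As 1 - (r+1) z is at least 1/(2k), each clique count is at least m/(2k^2) times the previous one.
   Hence k-cliques have positive density, and (k+1)-cliques are negligible against them. *)
have ratio j : (j <= r)%N -> m * N j.+1 <= 2 * k ^+ 2 * N j.+2.
  move=> lejr; have lej : j.+1%:R <= r.+1%:R :> R by rewrite ler_nat.
  have jz : j.+1%:R * z <= 1 by apply: le_trans (ler_wpM2r z0 lej) _; lra.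
  have H := clique_ratio z0 m0 edges jz.
  have H2 : m * N j.+1 * (1 - r.+1%:R * z) <= k * N j.+2.
    apply: le_trans (le_trans H _); last by rewrite ler_wpM2r // ler_nat ltnS.
    by rewrite ler_wpM2l ?mulr_ge0 // lerD2l lerN2 ler_wpM2r.
  have : m * N j.+1 * 2^-1 <= m * N j.+1 * (k * (1 - r.+1%:R * z)).
    by rewrite ler_wpM2l // mulr_ge0.
  have := ler_wpM2l (ler0n R r.+2) H2; rewrite -/k; lra.
have many j : (j <= r.+1)%N -> m ^+ j.+1 <= (2 * k ^+ 2) ^+ j * N j.+1.
  elim: j => [|j IHj] lej; first by rewrite mul1r cliques1.
  rewrite exprS; apply: le_trans (ler_wpM2l (ltW m0) (IHj (ltnW lej))) _.
  rewrite mulrCA [(_ ^+ j.+1)]exprSr -mulrA ler_wpM2l ?ratio //.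
  by rewrite exprn_ge0 // mulr_ge0 // exprn_ge0.
have Nk0 : 0 < N r.+2.
  rewrite lt_neqAle ler0n andbT eq_sym; apply/eqP => N0.
  by have := many r.+1 (leqnn _); rewrite N0 mulr0 leNgt exprn_gt0.
set S := (\sum_(C in cliques F e r.+2) \sum_(x in C) #|cls F e C x|)%N.
set I := (\sum_(C in cliques F e r.+2) \sum_(x in C) inner F e C x)%N.
have leI : I%:R <= m * (k * (r.+3%:R * N r.+3)).
  by rewrite /k -!natrM ler_nat; apply: sum_inner.
(* Cauchy-Schwarz on the extensions of (k-1)-cliques bounds the total class size from below, up to a
   term in (k+1)-cliques. *)
have geS : N r.+2 * m * (1 - r.+1%:R * eta) <= S%:R + k * (r.+3%:R * N r.+3).
  rewrite /k -!natrM -natrD /S sum_card_cls_cliques //.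
  set Q := (\sum_(C in _) _)%N.
  have CS : (k * N r.+2) ^+ 2 <= N r.+1 * Q%:R.
    rewrite /k -!natrM -natrX ler_nat -(sum_card_ext F e_sym e_irr).
    have := sum_power_mean (mem (cliques F e r.+1)) (fun=> 1%N)
      (fun C => #|ext F e C|) 1.
    rewrite sum1_card expn1 mulnC; under eq_bigr do rewrite mul1n.
    by under [X in (_ <= _ * X)%N]eq_bigr do rewrite mul1n.
  have rz1 : r.+1%:R * z <= 1 by lra.
  have H := clique_ratio z0 m0 edges rz1.
  have kN : 0 < k * N r.+2 by rewrite mulr_gt0 // ltr0n.
  have HQ : (k * N r.+2) * (m * (1 - r.+1%:R * z)) <= Q%:R.
    rewrite -(ler_pM2l kN).
    have := ler_wpM2r (ltW (mulr_gt0 m0 rz_pos)) CS.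
    by have := ler_wpM2r (ler0n R Q) H; rewrite -/k; lra.
  apply: le_trans HQ.
  have := ler_wpM2l (mulr_ge0 (ltW Nk0) (ltW m0)) rz; lra.
have few' : 2 * (m * (k * (r.+3%:R * N r.+3))) <= theta / 2 * (N r.+2 * m ^+ 2).
  have B1 : 1 <= 2 * k ^+ 2 by have : 1 <= k by [rewrite ler1n]; nra.
  have BN0 : 0 < (2 * k ^+ 2) ^+ r.+2 by rewrite exprn_gt0 // (lt_le_trans _ B1).
  have th0 : 0 <= theta.
    by apply: le_trans eta_th; rewrite !mulr_ge0.
  have manyk : m ^+ r.+2 <= (2 * k ^+ 2) ^+ r.+2 * N r.+2.
    apply: le_trans (many r.+1 (leqnn _)) _; rewrite ler_wpM2r //.
    exact: ler_weXn2l.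
  have {}few : 4 * r.+3%:R ^+ 2 * N r.+3 <= theta * m * N r.+2.
    rewrite -(ler_pM2l BN0); have := ler_wpM2l (mulr_ge0 th0 (ltW m0)) manyk.
    move: few; rewrite -/k [m ^+ r.+3]exprS; lra.
  have kr : k <= r.+3%:R by rewrite ler_nat.
  have := ler_wpM2l (ltW m0) few.
  have := ler_wpM2l (mulr_ge0 (mulr_ge0 (ltW m0) (ler0n R #|cliques F e r.+3|))
     (ler0n R r.+3)) kr.
  lra.
have tot : N r.+2 * m ^+ 2 - S%:R * m + I%:R <= N r.+2 * (theta * m ^+ 2).
  have := ler_wpM2r (ltW m0) geS.
  have := ler_wpM2r (mulr_ge0 (mulr_ge0 (ltW Nk0) (ltW m0)) (ltW m0)) eta_th.
  lra.
have [/exists_inP[C Ck leC]|/exists_inPn nex] := boolP [exists C in cliques F e r.+2, 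
    (m - (\sum_(x in C) #|cls F e C x|)%:R) * m + (\sum_(x in C) inner F e C x)%:R
      <= theta * m ^+ 2].
  by exists C.
have : \sum_(C in cliques F e r.+2) (theta * m ^+ 2) < \sum_(C in cliques F e r.+2)
   ((m - (\sum_(x in C) #|cls F e C x|)%:R) * m + (\sum_(x in C) inner F e C x)%:R).
  apply: ltr_sum => [|C /nex]; last by rewrite -ltNge.
  move: Nk0; rewrite ltr0n => /card_gt0P[C Ck].
  by apply/hasP; exists C; rewrite ?mem_index_enum.
rewrite sumr_const -[_ *+ #|cliques F e r.+2|]mulr_natl big_split /= -natr_sum.
rewrite -mulr_suml sumrB sumr_const -natr_sum -/S -/I.
rewrite -[_ *+ #|cliques F e r.+2|]mulr_natl; lra.
Qed.

End GoodClique.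

(** * The number of chains with prescribed layers *)

Section MinSqrt.
Variable R : rcfType.
Implicit Types x y : R.

(** Scaled to a cube with 2^w sets and a product p of layer sizes, this becomes min(p, sqrt(2^w p)):
    no loss while p <= 2^w, and a loss growing with p / 2^w beyond. *)
Definition min_sqrt x : R := Num.min x (Num.sqrt x).

Lemma min_sqrt_ge0 x : 0 <= x -> 0 <= min_sqrt x.
Proof. by move=> x0; rewrite le_min x0 sqrtr_ge0. Qed.

Lemma min_sqrt_le x : min_sqrt x <= x.
Proof. by rewrite ge_min lexx. Qed.

Lemma min_sqrt_le_sqrt x : min_sqrt x <= Num.sqrt x.
Proof. by rewrite ge_min lexx orbT. Qed.

Lemma le_min_sqrt x y : 0 <= x -> x <= y -> min_sqrt x <= min_sqrt y.
Proof.
by move=> x0 xy; rewrite le_min !ge_min xy ler_sqrt ?(le_trans x0) // xy orbT.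
Qed.

Lemma min_sqrt_id x : 0 <= x -> x <= 1 -> min_sqrt x = x.
Proof.
move=> x0 x1; apply: min_idPl; have := sqr_sqrtr x0; have := sqrtr_ge0 x.
have : Num.sqrt x <= 1 by rewrite -sqrtr1 ler_sqrt.
by nra.
Qed.

Lemma min_sqrt_sqrt x : 1 <= x -> min_sqrt x = Num.sqrt x.
Proof.
move=> x1; apply: min_idPr; have x0 : 0 <= x by lra.
have := sqr_sqrtr x0; have : 1 <= Num.sqrt x by rewrite -sqrtr1 ler_sqrt.
by nra.
Qed.

Lemma min_sqrt_mid x y : 0 <= x -> 0 <= y ->
  min_sqrt x + min_sqrt y <= 2 * min_sqrt ((x + y) / 2).
Proof.
move=> x0 y0; rewrite -ler_pdivrMl // le_min; apply/andP; split.
  by rewrite mulrC ler_pM2r ?invr_gt0 // lerD ?min_sqrt_le.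
have xy0 : 0 <= (x + y) / 2 by lra.
have := min_sqrt_le_sqrt x; have := min_sqrt_le_sqrt y.
have := sqr_sqrtr x0; have := sqr_sqrtr y0; have := sqr_sqrtr xy0.
have := sqrtr_ge0 x; have := sqrtr_ge0 y; have := sqrtr_ge0 ((x + y) / 2).
set s := Num.sqrt ((x + y) / 2); set a := Num.sqrt x; set b := Num.sqrt y.
move=> s0 b0 a0 es eb ea le1 le2.
have : (a + b) / 2 <= s.
  rewrite -(ler_pXn2r (ltn0Sn 1)) ?nnegrE //; last by lra.
  by have := sqr_ge0 (a - b); lra.
by lra.
Qed.

(* The hypothesis on triples makes all but the two largest [p i] negligible against [D],
   unless the largest one dominates; the strict concavity of the square root then
   leaves room for the others. *)
Lemma sum_min_sqrt (n : nat) (p : 'I_n -> R) (D : R) : (1 < n)%N ->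
  (forall i, 0 <= p i) -> 0 <= D ->
  (forall j m l : 'I_n, (j < m < l)%N -> p j * p l <= p m * D) ->
  \sum_i min_sqrt (p i) <=
  2 * min_sqrt ((\sum_i p i + D) / 2) + 7 * n%:R ^+ 3 * D.
Proof.
move=> n1 p0 D0 mid.
have [i0 _ max0] := Order.TotalTheory.arg_maxP p (isT : xpredT (Ordinal (ltnW n1))).
have [i' i'0] : exists i, i != i0.
  have [->|] := eqVneq i0 (Ordinal (ltnW n1)); first by exists (Ordinal n1).
  by rewrite eq_sym; exists (Ordinal (ltnW n1)).
have [i1 i10 max1] := Order.TotalTheory.arg_maxP (P := fun i => i != i0) p i'0.
set M := p i0 in max0 *; set M2 := p i1 in max1 *.
have le_M2 v : v != i0 -> p v <= M2 by exact: max1.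
have M2M : M2 <= M by exact: max0.
(* Whichever of [i0], [i1], [v] lies in the middle, [mid] gives this, because p v <= M2 <= M. *)
have mid' v : v != i0 -> v != i1 -> M2 * p v <= M * D.
  move=> v0 v1; have := le_M2 v v0; have := p0 v.
  have M20 : 0 <= M2 := p0 _.
  have : [|| (i0 < v < i1)%N, (i1 < v < i0)%N, (v < i0 < i1)%N, (i1 < i0 < v)%N,
    (i0 < i1 < v)%N | (v < i1 < i0)%N].
    by move: v0 v1 i10; rewrite -!(inj_eq val_inj) /=; lia.
  by case/or4P => [|||/or3P[||]] /mid; rewrite -/M -/M2; nra.
set P := \sum_i p i + D; set N := n%:R : R.
have N1 : 2 <= N by rewrite ler_nat.
rewrite (bigD1 i0) //= (bigD1 i1) //= addrA.
set rest := \sum_(i | _ && _) min_sqrt _.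
have P_eq : P = M + M2 + \sum_(i | (i != i0) && (i != i1)) p i + D.
  by rewrite /P (bigD1 i0) //= (bigD1 i1) //= !addrA.
have sum0 : 0 <= \sum_(i | (i != i0) && (i != i1)) p i by apply: sumr_ge0.
have P0 : 0 <= P by rewrite addr_ge0 // sumr_ge0.
have sum_le (Q : pred 'I_n) (c : R) :
    (forall i, Q i -> min_sqrt (p i) <= c) -> 0 <= c ->
    \sum_(i | Q i) min_sqrt (p i) <= N * c.
  move=> le_c c0; apply: (@le_trans _ _ (\sum_(i | Q i) c)).
    by apply: ler_sum => i; apply: le_c.
  rewrite sumr_const -mulr_natl ler_wpM2r // ler_nat.
  by rewrite -[leqRHS]card_ord max_card.
have M0 : 0 <= M := p0 _; have M20 : 0 <= M2 := p0 _.
have NN0 : 0 < N ^+ 2 by nra.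
(* If M <= 7 N^2 M2, every third term is at most 7 N^2 D and goes into the error, and [min_sqrt_mid]
   handles the two largest. Otherwise the largest term dominates, and the main term alone bounds the
   sum. *)
have [far|near] := ltP (7 * N ^+ 2 * M2) M; last first.
  have -> : 7 * N ^+ 3 * D = N * (7 * N ^+ 2 * D) by ring.
  apply: lerD; last first.
    apply: sum_le => [i /andP[ii0 ii1]|]; last by rewrite !mulr_ge0 // ltW.
    apply: le_trans (min_sqrt_le _) _; have := mid' i ii0 ii1.
    have [M2_0|M2_0] := eqVneq M2 0.
      by have := le_M2 i ii0; rewrite M2_0 => le0 _; apply: le_trans le0 _; nra.
    have M2_gt0 : 0 < M2 by rewrite lt_neqAle eq_sym M2_0.
    move=> H; rewrite -(ler_pM2l M2_gt0); apply: le_trans H _.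
    by have := ler_wpM2r D0 near; lra.
  apply: le_trans (min_sqrt_mid _ _) _ => //; rewrite ler_pM2l //.
  by rewrite -/M -/M2; apply: le_min_sqrt; lra.
apply: le_trans (_ : 2 * min_sqrt (P / 2) <= _); last first.
  by rewrite lerDl mulr_ge0 // mulr_ge0 // exprn_ge0 //; lra.
have [leM2|gtM2] := lerP M 2.
  have [leP2|gtP2] := lerP P 2.
    rewrite (min_sqrt_id (x := P / 2)); [|lra|lra].
    have : rest <= \sum_(i | (i != i0) && (i != i1)) p i.
      by apply: ler_sum => i _; apply: min_sqrt_le.
    have := min_sqrt_le M; have := min_sqrt_le M2; lra.
  have : 1 <= min_sqrt (P / 2).
    by rewrite -[X in X <= _](min_sqrt_id (x := 1)) ?le_min_sqrt //; lra.
  have : rest <= N * M2.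
    by apply: sum_le => // i /andP[ii0 _]; apply: le_trans (min_sqrt_le _) (le_M2 _ ii0).
  have : min_sqrt M <= 3 / 2.
    apply: le_trans (min_sqrt_le_sqrt M) _; have := sqr_sqrtr M0.
    by have := sqrtr_ge0 M; nra.
  have := min_sqrt_le M2.
  have : 14 * (N * M2) <= M by nra.
  nra.
set s := Num.sqrt M; have s0 : 0 <= s := sqrtr_ge0 M.
have sE : s ^+ 2 = M := sqr_sqrtr M0.
(* Here M2 < M / (7 N^2) and 1/7 < 4/25. The whole sum is then at most 7/5 sqrt M, and 7/5 < sqrt
   2. *)
have small : min_sqrt M2 <= 2 / 5 * (s / N).
  apply: le_trans (min_sqrt_le_sqrt M2) _.
  rewrite -(ler_pXn2r (ltn0Sn 1)) ?nnegrE ?sqrtr_ge0 ?mulr_ge0 ?invr_ge0 //.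
  - rewrite sqr_sqrtr // -(ler_pM2l NN0) !exprMn sE exprVn.
    rewrite [X in _ <= X](_ : _ = 4 / 25 * M); last by field; rewrite gt_eqF //; lra.
    by lra.
have rest_le : rest + min_sqrt M2 <= 2 / 5 * s.
  have -> : rest + min_sqrt M2 = \sum_(i | i != i0) min_sqrt (p i).
    by rewrite addrC (bigD1 i1).
  have -> : 2 / 5 * s = N * (2 / 5 * (s / N)) by field; rewrite gt_eqF //; lra.
  apply: sum_le => [i /le_M2 leM2|].
    by apply: le_trans small; apply: le_min_sqrt.
  exact: le_trans (min_sqrt_ge0 M20) small.
have : 7 / 5 * s <= 2 * Num.sqrt (P / 2).
  have P2 : 0 <= P / 2 by lra.
  have := sqr_sqrtr P2; have := sqrtr_ge0 (P / 2).
  have : M <= P by lra.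
  set t := Num.sqrt _ => leMP t0 tE.
  by rewrite -(ler_pXn2r (ltn0Sn 1)) ?nnegrE ?mulr_ge0 ?invr_ge0 //
    !exprMn sE tE; lra.
rewrite (min_sqrt_sqrt (x := P / 2)); last by lra.
by have := min_sqrt_le_sqrt M; rewrite -/s; lra.
Qed.

End MinSqrt.

Section ChainTuples.
Variables (T : finType) (k : nat).
Implicit Types (f : 'I_k -> {set {set T}}) (x : T) (W : {set T}).

Definition chain_tuples f : {set {ffun 'I_k -> {set T}}} :=
  [set g : {ffun 'I_k -> {set T}} | [forall i, g i \in f i] &&
    [forall i : 'I_k, forall j : 'I_k, (i <= j)%N ==> (g i \subset g j)]].

Lemma chain_tuplesP f (g : {ffun 'I_k -> {set T}}) :
  reflect ((forall i, g i \in f i) /\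
           (forall i j : 'I_k, (i <= j)%N -> g i \subset g j))
          (g \in chain_tuples f).
Proof.
rewrite inE; apply: (iffP andP) => [[/forallP gf H]|[gf H]]; split => //.
- by move=> i j ij; have /forallP/(_ j)/implyP := forallP H i; apply.
- exact/forallP.
- by apply/forallP=> i; apply/forallP=> j; apply/implyP; apply: H.
Qed.

Lemma chain_tuples_le f : (#|chain_tuples f| <= \prod_i #|f i|)%N.
Proof.
have -> : (\prod_i #|f i| = #|family (fun i => mem (f i))|)%N.
  by rewrite card_family foldrE big_map big_enum.
by apply/subset_leq_card/subsetP=> g /chain_tuplesP[gf _]; apply/familyP.
Qed.

Definition slice x f (b : {ffun 'I_k -> bool}) (i : 'I_k) : {set {set T}} :=
  [set A in f i | (x \in A) == b i].

(** A point that enters a chain stays in it, so along a chain its membership follows one of these k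
    + 1 patterns; [j] is the first layer containing it, or k if none does. *)
Definition threshold (j : 'I_k.+1) : {ffun 'I_k -> bool} :=
  [ffun i : 'I_k => (j <= i)%N].

Lemma threshold_inj : injective threshold.
Proof.
move=> j l /ffunP eq_jl; apply/val_inj.
wlog ltjl : j l eq_jl / (j < l)%N.
  move=> H; case: (ltngtP j l) => // lt; [exact: H|symmetry; exact: H].
have jk : (j < k)%N by apply: leq_trans ltjl _; rewrite -ltnS.
by have := eq_jl (Ordinal jk); rewrite !ffunE /= leqnn leqNgt ltjl.
Qed.

Lemma prod_slices x f :
  (\prod_i #|f i| = \sum_b \prod_i #|slice x f b i|)%N.
Proof.
pose c i (b : bool) := #|[set A in f i | (x \in A) == b]|.
rewrite -(bigA_distr_bigA c); apply: eq_bigr => i _.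
rewrite big_bool /c -(cardsID [set A : {set T} | x \in A] (f i)).
congr (_ + _)%N; apply: eq_card => A; rewrite !inE.
  by rewrite eqb_id.
by rewrite eqbF_neg andbC.
Qed.

Lemma sum_thresholds_le x f :
  (\sum_s \prod_i #|slice x f (threshold s) i| <= \prod_i #|f i|)%N.
Proof.
rewrite (prod_slices x).
rewrite (bigID (mem [set threshold s | s in 'I_k.+1])) /=.
by rewrite big_imset /= ?leq_addr // => s t _ _ /threshold_inj.
Qed.

Lemma chain_tuples_slice x f :
  (#|chain_tuples f| <= \sum_j #|chain_tuples (slice x f (threshold j))|)%N.
Proof.
apply: leq_trans (card_bigcup_le _ _); apply/subset_leq_card/subsetP=> g.
move=> /chain_tuplesP[gf gmono].
have [j xg] : exists j : 'I_k.+1, forall i, (x \in g i) = (j <= i)%N.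
  case: (pickP (fun i => x \in g i)) => [i0 xi0|no]; last first.
    by exists ord_max => i; rewrite no /= leqNgt ltn_ord.
  case: (arg_minnP (P := fun i => x \in g i) (fun i : 'I_k => i : nat) xi0) => i xi min_i.
  exists (widen_ord (leqnSn k) i) => l /=; apply/idP/idP => [/min_i //|il].
  exact: (subsetP (gmono i l il)).
apply/bigcupP; exists j => //; apply/chain_tuplesP; split => // i.
by rewrite inE gf xg ffunE /=.
Qed.

(* Crossing the thresholds j and l at m gives the pattern that is 1 exactly on
   [j, m) and [l, k), which is not a threshold, so its slice lies in the deficit. *)
Lemma slices_cross x f (j m l : 'I_k.+1) : (j < m < l)%N ->
  (\prod_i #|slice x f (threshold j) i| * \prod_i #|slice x f (threshold l) i| <=
   \prod_i #|slice x f (threshold m) i| *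
   (\prod_i #|f i| - \sum_s \prod_i #|slice x f (threshold s) i|))%N.
Proof.
case/andP=> jm ml; pose Q (b : {ffun 'I_k -> bool}) := (\prod_i #|slice x f b i|)%N.
pose c : {ffun 'I_k -> bool} := [ffun i : 'I_k => ((j <= i < m) || (l <= i))%N].
have -> : (\prod_i #|slice x f (threshold j) i| *
  \prod_i #|slice x f (threshold l) i| = Q (threshold m) * Q c)%N.
  rewrite /Q -!big_split; apply: eq_bigr => i _ /=.
  rewrite /slice !ffunE; case: (leqP l i) => li /=.
    rewrite (leq_trans (ltnW ml) li) (leq_trans _ li) ?orbT //.
    exact: ltnW (ltn_trans jm ml).
  rewrite orbF; case: (leqP m i) => mi /=; last by rewrite andbT mulnC.
  by rewrite (leq_trans (ltnW jm) mi).
rewrite leq_mul2l (prod_slices x); apply/orP; right.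
rewrite [X in (_ <= _ - X)%N](_ : _ = \sum_(b in [set threshold s | s in 'I_k.+1]) Q b)%N.
  rewrite [X in (_ <= X - _)%N](bigID (mem [set threshold s | s in 'I_k.+1])) /=.
  rewrite addKn (bigD1 c) ?leq_addr //=.
  apply/imsetP => -[s _ /ffunP cs].
  have jk : (j < k)%N by have := ltn_ord l; lia.
  have mk : (m < k)%N by have := ltn_ord l; lia.
  have := cs (Ordinal jk); have := cs (Ordinal mk); rewrite !ffunE /=.
  by lia.
by rewrite big_imset //= => s t _ _ /threshold_inj.
Qed.

(** Each layer sits in a cube of dimension |W|; different layers may differ outside [W]. *)
Definition const_off W f :=
  forall i A B, A \in f i -> B \in f i -> A :\: W = B :\: W.

Lemma const_off_slice x W f b : const_off W f -> const_off (W :\ x) (slice x f b).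
Proof.
move=> fW i A B; rewrite !inE => /andP[Af /eqP xA] /andP[Bf /eqP xB].
apply/setP=> y; have := fW i A B Af Bf => /setP/(_ y).
by rewrite !inE; case: (eqVneq y x) => [->|] //=; rewrite xA xB.
Qed.

Variable R : rcfType.
(** The solution of 7 (k+1)^3 gain = 1 - gain. The error 7 (k+1)^3 D of [sum_min_sqrt], over k + 1
    thresholds, is thus paid for by the tuples counted in D, which follow no threshold and so are
    not chains. *)
Definition gain : R := (1 + 7 * k.+1%:R ^+ 3)^-1.

Lemma gain_gt0 : 0 < gain.
Proof. by rewrite invr_gt0 ltr_wpDr // mulr_ge0 // exprn_ge0. Qed.

Lemma gain_le1 : gain <= 1.
Proof.
rewrite invf_le1 ?lerDl ?mulr_ge0 ?exprn_ge0 //.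
by rewrite ltr_wpDr // mulr_ge0 // exprn_ge0.
Qed.

(* When the product exceeds 2 ^ |W| by a constant factor, a constant fraction of the
   tuples are not chains.  The induction splits on a coordinate of W: a chain is
   determined there by the first layer whose member contains it. *)
Lemma chain_tuples_bound W f : (0 < k)%N -> const_off W f ->
  #|chain_tuples f|%:R <= (1 - gain) * (\prod_i #|f i|)%:R +
    gain * (2 ^+ #|W| * min_sqrt ((\prod_i #|f i|)%:R / 2 ^+ #|W|)) :> R.
Proof.
move=> k0; have [w] := ubnP #|W|; elim: w => // w IHw in W f *.
rewrite ltnS => leWw fW; have [W0|[x xW]] := set_0Vmem W.
  rewrite W0 cards0 expr0 divr1 mul1r.
  have le1 : (\prod_i #|f i| <= 1)%N.
    elim/big_ind: _ => // [a b|i _]; first by case: a b => [|[|a]] [|[|b]].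
    apply/card_le1_eqP => A B Af Bf; rewrite -(setD0 A) -(setD0 B) -W0.
    exact: fW Bf Af.
  rewrite min_sqrt_id ?ler_nat // ?ler_n1 //; last by rewrite -[1]/(1%:R) ler_nat.
  by rewrite -mulrDl subrK mul1r ler_nat chain_tuples_le.
have cW : #|W| = #|W :\ x|.+1 by rewrite (cardsD1 x W) xW.
pose p j : R := (\prod_i #|slice x f (threshold j) i|)%:R / 2 ^+ #|W :\ x|.
pose q : R := 2 ^+ #|W :\ x|; have q0 : 0 < q by rewrite exprn_gt0.
pose S := (\sum_s \prod_i #|slice x f (threshold s) i|)%N.
pose D : R := (\prod_i #|f i| - S)%:R / q.
have IH j : #|chain_tuples (slice x f (threshold j))|%:R <=
    q * ((1 - gain) * p j + gain * min_sqrt (p j)).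
  apply: le_trans (IHw (W :\ x) _ _ _) _; first by rewrite -ltnS -cW.
    exact: const_off_slice.
  rewrite -/q /p -/q mulrDr [q * (gain * _)]mulrCA [q * (_ * (_ / q))]mulrCA.
  by rewrite [q * (_ / q)]mulrC divfK // gt_eqF.
have sumD : \sum_j p j + D = (\prod_i #|f i|)%:R / q.
  by rewrite /p -mulr_suml -natr_sum -mulrDl -natrD subnKC ?sum_thresholds_le.
have p0 j : 0 <= p j by rewrite divr_ge0 ?ler0n // ltW.
have D0 : 0 <= D by rewrite divr_ge0 ?ler0n // ltW.
have mid (j m l : 'I_k.+1) : (j < m < l)%N -> p j * p l <= p m * D.
  move=> jml; rewrite /p /D mulrACA [leRHS]mulrACA -!natrM.
  by rewrite ler_pM2r ?mulr_gt0 ?invr_gt0 // ler_nat slices_cross.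
have := sum_min_sqrt (p := p) k0 p0 D0 mid; rewrite sumD => num.
have gainE : gain * (7 * k.+1%:R ^+ 3) = 1 - gain.
  have pos : 0 < 1 + 7 * k.+1%:R ^+ 3 :> R.
    by rewrite ltr_wpDr // mulr_ge0 // exprn_ge0.
  apply: (canRL (addrK _)); rewrite -[X in _ + X]mulr1 -mulrDr [_ + 1]addrC.
  by rewrite /gain mulVf // gt_eqF.
have : #|chain_tuples f|%:R <= \sum_j q * ((1 - gain) * p j + gain * min_sqrt (p j)).
  apply: le_trans (_ : (\sum_j #|chain_tuples (slice x f (threshold j))|)%:R <= _).
    by rewrite ler_nat chain_tuples_slice.
  by rewrite natr_sum; apply: ler_sum => j _; apply: IH.
move=> /le_trans; apply; rewrite -mulr_sumr big_split /= -!mulr_sumr cW exprS -/q.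
have P_eq : (\prod_i #|f i|)%:R = q * (\sum_j p j + D).
  by rewrite sumD mulrC divfK // gt_eqF.
have -> : (\prod_i #|f i|)%:R / (2 * q) = (\prod_i #|f i|)%:R / q / 2 :> R.
  by rewrite invfM mulrCA mulrC.
move: num; set ms := min_sqrt (_ / q / 2); set Sm := \sum_i min_sqrt (p i).
rewrite P_eq; set Sp := \sum_i p i; set K := 7 * _ in gainE *; move=> num.
have h := ler_wpM2l (mulr_ge0 (ltW q0) (ltW gain_gt0)) num.
have : gain * K * D = (1 - gain) * D by rewrite gainE.
move=> /(congr1 (fun z => q * z)); lra.
Qed.

End ChainTuples.

(** * Bernoulli's inequality and a Markov-type count *)

Lemma bernoulli (R : realDomainType) (x : R) n :
  0 <= x -> x <= 1 -> 1 - n%:R * x <= (1 - x) ^+ n.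
Proof.
move=> x0 x1; elim: n => [|n IHn]; first by rewrite expr0; lra.
have x1' : 0 <= 1 - x by lra.
have := ler_wpM2l x1' IHn; rewrite -exprS; apply: le_trans.
by rewrite -natr1; have := mulr_ge0 (ler0n R n) (mulr_ge0 x0 x0); lra.
Qed.

Lemma markov_count (R : realFieldType) (I J : finType) (A A' : {set I})
    (B : {set J}) (r : I -> J -> bool) (c del : R) :
  A' \subset A -> 0 < c -> (0 < #|B|)%N ->
  (forall a, a \in A' -> c * #|B|%:R <= #|[set b in B | r a b]|%:R) ->
  (\sum_(a in A) \sum_(b in B) r a b)%:R <= del * (#|A| * #|B|)%:R ->
  #|A'|%:R <= c^-1 * del * #|A|%:R.
Proof.
move=> sub c0 B0 dense few; have B0' : 0 < #|B|%:R :> R by rewrite ltr0n.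
rewrite -(ler_pM2r (mulr_gt0 c0 B0')).
apply: le_trans (_ : (\sum_(a in A) \sum_(b in B) r a b)%:R <= _); last first.
  apply: le_trans few _; rewrite natrM.
  rewrite [X in _ <= X](_ : _ = c^-1 * c * (del * (#|A|%:R * #|B|%:R))); last by ring.
  by rewrite mulVf ?mul1r // gt_eqF.
rewrite natr_sum (big_setID A') /= (setIidPr sub) -[X in X <= _]addr0.
apply: lerD; last by apply: sumr_ge0.
rewrite mulr_natl -sumr_const; apply: ler_sum => a /dense/le_trans; apply.
rewrite ler_nat -sum1_card big_mkcond [leqRHS]big_mkcond.
by apply: leq_sum => b _; rewrite inE; case: (b \in B); case: (r a b).
Qed.

(** * Towers from nearly nested layers *)

Section MostlyNested.
Variables (R : rcfType) (T : finType) (k : nat) (G : 'I_k -> {set {set T}}).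
Variable del : R.
Local Notation n := #|T|.
Local Notation P := ((\prod_i #|G i|)%:R : R).

Definition missing i j : {set {set T} * {set T}} :=
  [set p in setX (G i) (G j) | ~~ (p.1 \subset p.2)].

Hypothesis k_gt0 : (0 < k)%N.
Hypothesis del_ge0 : 0 <= del.
Hypothesis del_gain : 7 * k%:R ^+ 2 * del < gain k R.
Hypothesis del_small : 64 * k%:R ^+ 2 * del <= 1.
Hypothesis G_gt0 : forall i, (0 < #|G i|)%N.
Hypothesis prod_ge : 7 / 8 * 2 ^+ n <= P.
Hypothesis G_ge : forall i, 7 / 8 * 2 ^+ n <= #|G i|%:R ^+ k :> R.
Hypothesis few_missing : forall i j : 'I_k, (i < j)%N ->
  #|missing i j|%:R <= del * (#|G i| * #|G j|)%:R :> R.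

Lemma card_crossing (i j : 'I_k) : (i < j)%N ->
  #|[set g : {ffun 'I_k -> {set T}} | (g \in family (fun l => mem (G l))) &&
      ~~ (g i \subset g j)]|%:R <= del * P.
Proof.
move=> ij; have ne : j != i by apply: contraTneq ij => ->; rewrite ltnn.
pose Q := (\prod_(l | (l != i) && (l != j)) #|G l|)%N.
have P_eq : P = (#|G i| * #|G j|)%:R * Q%:R.
  by rewrite (bigD1 i) //= (bigD1 j) //= mulnA natrM.
apply: (@le_trans _ _ (#|missing i j|%:R * Q%:R)); last first.
  by rewrite P_eq mulrA ler_wpM2r // few_missing.
rewrite -natrM ler_nat.
pose H (p : {set T} * {set T}) l : {set {set T}} :=
  if l == i then [set p.1] else if l == j then [set p.2] else G l.
apply: (@leq_trans #|\bigcup_(p in missing i j)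
    [set g : {ffun 'I_k -> {set T}} | g \in family (fun l => mem (H p l))]|).
  apply/subset_leq_card/subsetP=> g; rewrite inE => /andP[/familyP gG gij].
  apply/bigcupP; exists (g i, g j); first by rewrite !inE !gG gij.
  rewrite inE; apply/familyP=> l; rewrite /H /= .
  by have [->|_] := eqVneq l i; [|have [->|_] := eqVneq l j]; rewrite ?set11.
apply: leq_trans (card_bigcup_le _ _) _; rewrite -sum_nat_const.
apply: leq_sum => p _; rewrite cardsE card_family foldrE big_map big_enum /=.
rewrite (bigD1 i) //= (bigD1 j) //= /H eqxx cards1 (negbTE ne) eqxx cards1 !mul1n.
apply: eq_leq; apply: eq_bigr => l /andP[li lj].
by rewrite (negbTE li) (negbTE lj).
Qed.

(** Union bound over the fewer than k^2 pairs i < j, each spoiling at most the share [del] of the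
    tuples. *)
Lemma many_chain_tuples : (1 - k%:R ^+ 2 * del) * P <= #|chain_tuples G|%:R.
Proof.
set Fam := [set g : {ffun 'I_k -> {set T}} | g \in family (fun l => mem (G l))].
have cFam : P = #|Fam|%:R.
  by rewrite cardsE card_family foldrE big_map big_enum.
pose cross (p : 'I_k * 'I_k) := [set g in Fam | ~~ (g p.1 \subset g p.2)].
have cover : Fam :\: chain_tuples G \subset \bigcup_(p : 'I_k * 'I_k | (p.1 < p.2)%N) cross p.
  apply/subsetP=> g; rewrite in_setD => /andP[nchain gF].
  have gG : forall i, g i \in G i by move: gF; rewrite inE => /familyP.
  apply: contraR nchain => nc; apply/chain_tuplesP; split=> // i j ij.
  have [<- //|ne] := eqVneq i j; apply: contraR nc => gij.
  apply/bigcupP; exists (i, j); first by rewrite ltn_neqAle ij ne.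
  by rewrite in_set gF.
have : #|Fam :\: chain_tuples G|%:R <= k%:R ^+ 2 * del * P.
  apply: (@le_trans _ _ (\sum_(p : 'I_k * 'I_k | (p.1 < p.2)%N) del * P)).
    apply: (@le_trans _ _ (\sum_(p : 'I_k * 'I_k | (p.1 < p.2)%N) #|cross p|%:R)).
      by rewrite -natr_sum ler_nat (leq_trans (subset_leq_card cover)) ?card_bigcup_le.
    apply: ler_sum => p lt_p; apply: le_trans (card_crossing lt_p).
    by rewrite ler_nat subset_leq_card //; apply/subsetP=> g; rewrite !inE.
  rewrite sumr_const -[leLHS]mulr_natl -[leRHS]mulrA ler_wpM2r ?mulr_ge0 //.
  rewrite -natrX ler_nat (leq_trans (max_card _)) // card_prod card_ord.
  exact: leqnn.
have : (#|Fam| <= #|Fam :\: chain_tuples G| + #|chain_tuples G|)%N.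
  by rewrite -(cardsID (chain_tuples G) Fam) addnC leq_add2l subset_leq_card ?subsetIr.
by rewrite -(ler_nat R) natrD -cFam; lra.
Qed.

(* If almost all tuples sliced by x followed one threshold, they would live in a cube of
   dimension n - 1 with a product well above 2 ^ (n - 1), so many would not be chains. *)
Lemma no_full_slice x (j : 'I_k.+1) :
  (\prod_i #|slice x G (threshold j) i|)%:R < 7 / 8 * P.
Proof.
rewrite ltNge; apply/negP=> full; set p := (\prod_i #|slice _ _ _ _|)%N in full.
have cT : n = #|[set~ x]|.+1 by rewrite cardsC1 prednK //; apply/card_gt0P; exists x.
set q : R := 2 ^+ #|[set~ x]|; have q0 : 0 < q by rewrite exprn_gt0.
have P_ge : 7 / 4 * q <= P by move: prod_ge; rewrite cT exprS -/q; lra.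
have off : const_off [set~ x] (slice x G (threshold j)).
  have -> : [set~ x] = [set: T] :\ x by rewrite setTD.
  by apply: const_off_slice => i A B _ _; rewrite !setDT.
have := chain_tuples_bound R k_gt0 off; rewrite -/p -/q => bound.
have y_ge : 49 / 32 <= p%:R / q by rewrite ler_pdivlMr //; lra.
have sqrt_le : min_sqrt (p%:R / q) <= 5 / 6 * (p%:R / q).
  apply: le_trans (min_sqrt_le_sqrt _) _; set y := _ / q in y_ge *.
  have y0 : 0 <= y by lra.
  rewrite -(ler_pXn2r (ltn0Sn 1)) ?nnegrE ?sqrtr_ge0 //; last by lra.
  by rewrite sqr_sqrtr //; nra.
have g0 := gain_gt0 k R.
have qsqrt_le : q * min_sqrt (p%:R / q) <= 5 / 6 * p%:R.
  have := ler_wpM2l (ltW q0) sqrt_le; rewrite mulrCA [q * (_ / q)]mulrCA.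
  by rewrite divff ?gt_eqF // mulr1.
have {qsqrt_le} := ler_wpM2l (ltW g0) qsqrt_le.
have : #|chain_tuples G|%:R <=
    P - p%:R + #|chain_tuples (slice x G (threshold j))|%:R.
  apply: le_trans (_ : (\sum_s #|chain_tuples (slice x G (threshold s))|)%:R <= _).
    by rewrite ler_nat chain_tuples_slice.
  rewrite (bigD1 j) //= natrD addrC lerD2r lerBrDr -natrD ler_nat.
  apply: leq_trans (sum_thresholds_le x G); rewrite [leqRHS](bigD1 j) //= addnC.
  by rewrite leq_add2l; apply: leq_sum => s _; apply: chain_tuples_le.
have P0 : 0 < P by lra.
have := ler_wpM2l (ltW g0) full; have := many_chain_tuples.
have : 7 * k%:R ^+ 2 * del * P < gain k R * P by rewrite ltr_pM2r.
have := mulr_gt0 g0 P0; lra.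
Qed.

Definition density x i : R := #|[set A in G i | x \in A]|%:R / #|G i|%:R.

(** Densities strictly between [c] and 1 - [c] count as intermediate. Bernoulli gives (1 - c)^k >=
    7/8 for [no_gap], and c^2 = 1/(64 k^2) is at least [del] for [density_step]. *)
Let c : R := (8 * k%:R)^-1.

Lemma k_ge1 : 1 <= k%:R :> R.
Proof. by rewrite ler1n. Qed.

Lemma c_gt0 : 0 < c.
Proof. by rewrite invr_gt0 mulr_gt0 // ltr0n. Qed.

Lemma kc : k%:R * c = 1 / 8.
Proof. by rewrite /c; field; have := k_ge1; lra. Qed.

Lemma c_le : c <= 1 / 8.
Proof. by have := k_ge1; have := kc; have := c_gt0; nra. Qed.

Lemma del_le_c2 : del <= c ^+ 2.
Proof.
have c2 : 64 * k%:R ^+ 2 * c ^+ 2 = 1.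
  have : (k%:R * c) ^+ 2 = 1 / 64 by rewrite kc; lra.
  by rewrite exprMn; lra.
have k2 : 0 < 64 * k%:R ^+ 2 :> R by have := k_ge1; nra.
by rewrite -(ler_pM2l k2) c2.
Qed.

Lemma densityE x i : density x i * #|G i|%:R = #|[set A in G i | x \in A]|%:R.
Proof. by rewrite divfK // pnatr_eq0 -lt0n. Qed.

Lemma densityCE x i :
  (1 - density x i) * #|G i|%:R = #|[set A in G i | x \notin A]|%:R.
Proof.
rewrite mulrBl mul1r densityE -(cardsID [set A : {set T} | x \in A] (G i)) natrD.
rewrite [X in X%:R + _](_ : _ = #|[set A in G i | x \in A]|); last first.
  by apply: eq_card => A; rewrite !inE.
by rewrite addrC addKr; congr _%:R; apply: eq_card => A; rewrite !inE andbC.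
Qed.

Lemma density_le1 x i : density x i <= 1.
Proof.
have Gi : 0 < #|G i|%:R :> R by rewrite ltr0n.
by rewrite -subr_ge0 -(pmulr_lge0 _ Gi) densityCE.
Qed.

(** A set of layer i containing [x] is never inside a set of layer j avoiding [x], so
    [density x i * (1 - density x j)] is at most [del], hence at most c^2. *)
Lemma density_step x (i j : 'I_k) :
  (i < j)%N -> c <= density x i -> 1 - c <= density x j.
Proof.
move=> ij ci; suff : density x i * (1 - density x j) <= del.
  by have := del_le_c2; have := c_gt0; have := density_le1 x j; nra.
have Gij : 0 < (#|G i| * #|G j|)%:R :> R by rewrite ltr0n muln_gt0 !G_gt0.
rewrite -(ler_pM2r Gij); apply: le_trans (few_missing ij).
rewrite natrM mulrACA densityE densityCE -natrM ler_nat -cardsX.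
apply/subset_leq_card/subsetP=> -[A B]; rewrite !inE /=.
case/andP=> /andP[-> xA] /andP[-> xB] /=; apply: contraNN xB => /subsetP; exact.
Qed.

(** Without an intermediate layer, the slice along threshold [j] keeps at least 1 - k c = 7/8 of the
    product, against [no_full_slice]. *)
Lemma no_gap x (j : 'I_k.+1) :
  (forall i : 'I_k, (i < j)%N -> density x i <= c) ->
  (forall i : 'I_k, (j <= i)%N -> 1 - c <= density x i) -> False.
Proof.
move=> lo hi; have := no_full_slice x j; apply/negP; rewrite -leNgt.
have -> : (\prod_i #|slice x G (threshold j) i|)%:R =
  \prod_(i < k) ((if (j <= i)%N then density x i else 1 - density x i) * #|G i|%:R).
  rewrite natr_prod; apply: eq_bigr => i _; rewrite /slice ffunE.
  case: (j <= i)%N; [rewrite densityE|rewrite densityCE]; congr _%:R;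
    by apply: eq_card => A; rewrite !inE; case: (x \in A); rewrite ?andbT ?andbF.
rewrite big_split -natr_prod /= ler_wpM2r //.
apply: (@le_trans _ _ (\prod_(i < k) (1 - c))).
  rewrite prodr_const card_ord; apply: le_trans (bernoulli _ _ _).
  - by rewrite kc; lra.
  - exact: ltW c_gt0.
  - by have := c_le; lra.
apply: ler_prod => i _; rewrite subr_ge0 (le_trans c_le) /=; last by lra.
by case: leqP => [/hi //|/lo]; lra.
Qed.

(** The chain X_i of the tower. At i = k [insub] fails and the default is the full set, the top of
    the tower. *)
Definition level (i : nat) : {set T} :=
  if insub i is Some i' then [set x | 1 - c <= density x i'] else setT.

Lemma mem_level x (i : 'I_k) : (x \in level i) = (1 - c <= density x i).
Proof. by rewrite /level valK inE. Qed.

Lemma level0 : level 0 = set0.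
Proof.
apply/setP=> x; rewrite inE -[0%N]/(val (Ordinal k_gt0)) mem_level.
apply/negP => le0; apply: (no_gap (x := x) (j := ord0)) => // i _.
have [i0|i0] := posnP i.
  by rewrite (_ : i = Ordinal k_gt0) //; apply/val_inj.
by apply: (density_step (i := Ordinal k_gt0)) => //; have := c_le; lra.
Qed.

Lemma levelk : level k = setT.
Proof. by rewrite /level insubF // ltnn. Qed.

(** Density [c] in layer i forces density 1 - [c] in layer i + 1; conversely, a jump from below [c]
    to at least 1 - [c] is a gap excluded by [no_gap]. For i = k - 1 every point has density at
    least [c]. *)
Lemma mem_levelS x (i : 'I_k) : (x \in level i.+1) = (c <= density x i).
Proof.
have lt_c : c < 1 - c by have := c_le; lra.
apply/idP/idP=> [x_level|le_i].
  rewrite leNgt; apply/negP=> lt_i.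
  apply: (no_gap (x := x) (j := lift ord0 i)) => l; rewrite /= /bump /= add1n.
    rewrite ltnS leq_eqVlt => /orP[/eqP/val_inj -> |li]; first exact: ltW.
    rewrite leNgt; apply/negP=> /ltW le_l.
    by have := density_step li le_l; lra.
  move=> il; have iSk : (i.+1 < k)%N by apply: leq_ltn_trans il (ltn_ord l).
  have x_iS : 1 - c <= density x (Ordinal iSk) by rewrite -mem_level.
  have [eq_l|lt_l] := eqVneq (i.+1 : nat) l.
    by rewrite (_ : l = Ordinal iSk) //; apply/val_inj.
  apply: (density_step (i := Ordinal iSk)); last by lra.
  by rewrite /= ltn_neqAle lt_l.
have := ltn_ord i; rewrite leq_eqVlt => /orP[/eqP ->|iSk].
  by rewrite levelk inE.
by rewrite -[i.+1]/(val (Ordinal iSk)) mem_level; apply: density_step le_i.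
Qed.

Lemma level_sub i : (i < k)%N -> level i \subset level i.+1.
Proof.
move=> ik; apply/subsetP=> x; rewrite -[i]/(val (Ordinal ik)) mem_level mem_levelS.
by have := c_le; lra.
Qed.

Lemma card_missing i j :
  #|missing i j| = (\sum_(A in G i) \sum_(B in G j) ~~ (A \subset B))%N.
Proof.
rewrite pair_big /= -sum1_card big_mkcond [RHS]big_mkcond.
apply: eq_bigr => -[A B] _; rewrite !inE /=.
by case: (A \in G i) (B \in G j) (A \subset B) => [] [] [].
Qed.

(** A set of layer i not inside [level i.+1] has a point that more than the share [c] of layer i + 1
    avoids, and it lies in none of those sets; [markov_count] bounds the number of such sets. *)
Lemma few_above i :
  #|[set A in G i | ~~ (A \subset level i.+1)]|%:R <= c^-1 * del * #|G i|%:R.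
Proof.
have sub : [set A in G i | ~~ (A \subset level i.+1)] \subset G i.
  by apply/subsetP=> A; rewrite inE => /andP[].
have := ltn_ord i; rewrite leq_eqVlt => /orP[/eqP ik|iSk].
  rewrite (_ : [set A in G i | _] = set0) ?cards0.
    by rewrite !mulr_ge0 // invr_ge0 ltW // c_gt0.
  by apply/setP=> A; rewrite !inE ik levelk subsetT andbF.
have lt_i : (i < Ordinal iSk)%N by [].
apply: (markov_count (B := G (Ordinal iSk)) (r := fun A B : {set T} => ~~ (A \subset B)) sub c_gt0);
  rewrite ?G_gt0 -?card_missing ?few_missing // => A.
rewrite inE => /andP[_ /subsetPn[x xA]].
rewrite -[i.+1]/(val (Ordinal iSk)) mem_level -ltNge => x_lt.
apply: (@le_trans _ _ #|[set B in G (Ordinal iSk) | x \notin B]|%:R).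
  by rewrite -densityCE ler_wpM2r //; lra.
rewrite ler_nat; apply/subset_leq_card/subsetP=> B; rewrite !inE.
by case/andP=> -> /=; apply: contraNN => /subsetP; apply.
Qed.

(** Dual to [few_above]: by [mem_levelS], a point of [level i] lies in at least the share [c] of
    layer i - 1. *)
Lemma few_below i :
  #|[set A in G i | ~~ (level i \subset A)]|%:R <= c^-1 * del * #|G i|%:R.
Proof.
have sub : [set A in G i | ~~ (level i \subset A)] \subset G i.
  by apply/subsetP=> A; rewrite inE => /andP[].
have [i0|i0] := posnP i.
  rewrite (_ : [set A in G i | _] = set0) ?cards0.
    by rewrite !mulr_ge0 // invr_ge0 ltW // c_gt0.
  by apply/setP=> A; rewrite !inE i0 level0 sub0set andbF.
have i'k : (i.-1 < k)%N by rewrite prednK // ltnW.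
have lt_i : (Ordinal i'k < i)%N by rewrite /= prednK.
apply: (markov_count (B := G (Ordinal i'k)) (r := fun A B : {set T} => ~~ (B \subset A)) sub c_gt0);
  rewrite ?G_gt0 //.
  move=> A; rewrite inE => /andP[_ /subsetPn[x]].
  rewrite -[in level _](prednK i0) -[i.-1]/(val (Ordinal i'k)) mem_levelS => x_ge xA.
  apply: (@le_trans _ _ #|[set B in G (Ordinal i'k) | x \in B]|%:R).
    by rewrite -densityE ler_wpM2r.
  rewrite ler_nat; apply/subset_leq_card/subsetP=> B; rewrite !inE.
  by case/andP=> -> xB /=; apply: contraNN xA => /subsetP; apply.
by rewrite exchange_big -card_missing /= mulnC few_missing.
Qed.

Lemma few_outside (i : 'I_k) :
  #|G i :\: between (G i) (level i) (level i.+1)|%:R <=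
  16 * k%:R * del * #|G i|%:R.
Proof.
have -> : 16 * k%:R * del * #|G i|%:R =
    c^-1 * del * #|G i|%:R + c^-1 * del * #|G i|%:R by rewrite /c invrK; ring.
apply: le_trans (lerD (few_above i) (few_below i)).
rewrite -natrD ler_nat -leq_subLR.
apply: leq_trans (leq_sub2r _ (subset_leq_card (_ : _ \subset
  [set A in G i | ~~ (A \subset level i.+1)] :|:
  [set A in G i | ~~ (level i \subset A)]))) _.
  apply/subsetP=> A; rewrite !inE; case: (A \in G i) => //=.
  by rewrite andbT negb_and orbC.
by rewrite leq_subLR cardsU leq_subr.
Qed.

(** The cube holds at least (1 - 16 k del) |G_i| sets, so 2^(k d) >= 3/4 7/8 2^n > 2^(n-1), and k d
    is an integer. *)
Lemma level_dim_ge (i : 'I_k) : (n <= k * (#|level i.+1| - #|level i|))%N.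
Proof.
have le_d := card_between (G i) (level i) (level i.+1).
set d := (_ - _)%N in le_d *; clearbody d.
have few := few_outside i; set Bt := between _ _ _ in le_d few.
have rho : 16 * k%:R * del <= 1.
  have := k_ge1; have := mulr_ge0 (ler0n R k) del_ge0; have := del_small.
  by set K := k%:R : R; nra.
have ge_d : (1 - 16 * k%:R * del) * #|G i|%:R <= 2 ^+ d.
  have : #|Bt|%:R <= 2 ^+ d :> R by rewrite -natrX ler_nat.
  have : #|G i|%:R <= #|Bt|%:R + #|G i :\: Bt|%:R :> R.
    rewrite -natrD ler_nat -(cardsID Bt (G i)) leq_add2r subset_leq_card //.
    exact: subsetIr.
  by lra.
have r0 : 0 <= 1 - 16 * k%:R * del by lra.
have := lerXn2r k (_ : _ \in Num.nneg) (_ : _ \in Num.nneg) ge_d.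
rewrite !nnegrE mulr_ge0 // exprn_ge0 // => /(_ isT isT).
rewrite exprMn -exprM mulnC => ge_kd.
have bern : 3 / 4 <= (1 - 16 * k%:R * del) ^+ k.
  apply: le_trans (bernoulli _ _ rho); last by rewrite !mulr_ge0.
  by have := del_small; lra.
rewrite -ltnS -(ltr_eXn2l (x := 2 : R)) ?ltr1n // exprS.
have two_n : 0 < 2 ^+ n :> R by rewrite exprn_gt0.
have : 3 / 4 * (7 / 8 * 2 ^+ n) <= 2 ^+ (k * d) :> R.
  apply: le_trans ge_kd; apply: ler_pM; [lra|lra|exact: bern|exact: G_ge].
by lra.
Qed.

Lemma level_dim (i : nat) : (i < k)%N -> (k * (#|level i.+1| - #|level i|) = n)%N.
Proof.
move=> ik; have sum_dim : (\sum_(j < k) (#|level j.+1| - #|level j|) = n)%N.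
  rewrite -(big_mkord xpredT (fun j => #|level j.+1| - #|level j|)%N).
  rewrite telescope_sumn_in // => [|j /andP[_ jk]]; last first.
    by rewrite subset_leq_card // level_sub.
  by rewrite levelk level0 cards0 subn0 cardsT.
have sum_n : (\sum_(j < k) n = \sum_(j < k) k * (#|level j.+1| - #|level j|))%N.
  by rewrite -big_distrr /= sum_dim sum_nat_const card_ord.
apply/eqP; rewrite eqn_leq [X in _ && X](level_dim_ge (Ordinal ik)) andbT.
move: sum_n; rewrite (bigD1 (Ordinal ik)) //= [RHS](bigD1 (Ordinal ik)) //= => sum_n.
rewrite -(leq_add2r (\sum_(j < k | j != Ordinal ik) k * (#|level j.+1| - #|level j|))).
rewrite -sum_n leq_add2l; apply: leq_sum => j _; exact: level_dim_ge.
Qed.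

End MostlyNested.

(** * Layers from a good clique *)

Section Comparability.
Variable T : finType.
Implicit Types (A B U : {set T}) (F C : {set {set T}}).

Definition comparable_sets A B := (A != B) && ((A \subset B) || (B \subset A)).

Lemma comparable_sets_sym : symmetric comparable_sets.
Proof. by move=> A B; rewrite /comparable_sets eq_sym orbC. Qed.

Lemma comparable_sets_irr : irreflexive comparable_sets.
Proof. by move=> A; rewrite /comparable_sets eqxx. Qed.

Lemma comparable_sets_proper A B : comparable_sets A B -> (#|A| <= #|B|)%N -> A \proper B.
Proof.
rewrite /comparable_sets properEneq => /andP[ne /orP[-> _|BA AB]]; first by rewrite ne.
by case/eqP: ne; apply/esym/eqP; rewrite eqEcard BA.
Qed.

(** The smallest member of a clique lies below all others, so removing it leaves a clique among the
    sets above it. *)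
Lemma cliques_le_nchains F j U :
  (#|cliques [set A in F | U \subset A] comparable_sets j| <= nchains F j U)%N.
Proof.
elim: j U => [|j IHj] U.
  apply: (@leq_trans #|[set set0 : {set {set T}}]|); last by rewrite cards1.
  apply/subset_leq_card/subsetP=> C; rewrite !inE => /and3P[_ C0 _].
  by rewrite -cards_eq0.
pose img A := [set A |: C | C in cliques [set B in F | A \subset B] comparable_sets j].
apply: (@leq_trans #|\bigcup_(A in F | U \subset A) img A|).
  apply/subset_leq_card/subsetP=> C C_in.
  have := C_in; rewrite inE => /and3P[/subsetP sub /eqP cC /is_cliqueP C_cl].
  have [A0 A0C] : exists A, A \in C by apply/set0Pn; rewrite -card_gt0 cC.
  have [A AC min_A] := arg_minnP (P := mem C) (fun A => #|A|) A0C.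
  have {}AC : A \in C := AC.
  have A_sub B : B \in C -> A \subset B.
    move=> BC; have [<- //|ne] := eqVneq A B.
    exact/proper_sub/comparable_sets_proper/min_A/BC/C_cl.
  have := sub A AC; rewrite inE => /andP[AF UA].
  apply/bigcupP; exists A; rewrite ?AF //; apply/imsetP; exists (C :\ A).
    rewrite inE; apply/and3P; split.
    - apply/subsetP=> B /setD1P[_ BC]; rewrite inE A_sub // andbT.
      by have := sub B BC; rewrite inE => /andP[].
    - by move: cC; rewrite (cardsD1 A) AC add1n => -[->].
    - by apply/is_cliqueP=> B B' /setD1P[_ BC] /setD1P[_ BC']; apply: C_cl.
  by rewrite setD1K.
apply: leq_trans (card_bigcup_le _ _) _; rewrite nchainsS; apply: leq_sum => A _.
exact: leq_trans (leq_imset_card _ _) (IHj A).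
Qed.

Lemma card_cliques_le F j : (#|cliques F comparable_sets j| <= nchains F j set0)%N.
Proof.
apply: leq_trans (cliques_le_nchains F j set0).
by rewrite (_ : [set A in F | _] = F) //; apply/setP=> A; rewrite inE sub0set andbT.
Qed.

Lemma clique_chain F k C : C \in cliques F comparable_sets k ->
  exists c : 'I_k -> {set T},
    [/\ injective c, C = [set c i | i in 'I_k] &
        forall i j : 'I_k, (i < j)%N -> c i \proper c j].
Proof.
rewrite inE => /and3P[_ /eqP cC /is_cliqueP C_cl].
pose leT := relpre (fun A : {set T} => #|A|) leq; pose s := sort leT (enum C).
have sz : size s = k by rewrite size_sort -cardE.
have s_sorted : sorted leT s by apply: sort_sorted => A B; apply: leq_total.
have s_uniq : uniq s by rewrite sort_uniq enum_uniq.
have mem_s A : (A \in s) = (A \in C) by rewrite mem_sort mem_enum.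
exists (fun i => nth set0 s i); split.
- by move=> i j /eqP; rewrite nth_uniq ?sz // => /eqP/val_inj.
- apply/setP=> A; rewrite -mem_s; apply/idP/imsetP => [As|[i _ ->]].
    have ltk : (index A s < k)%N by rewrite -sz index_mem.
    by exists (Ordinal ltk); rewrite //= nth_index.
  by rewrite mem_nth // sz.
move=> i j ij; apply: comparable_sets_proper.
  by apply: C_cl; rewrite -?mem_s ?mem_nth ?sz // nth_uniq ?sz // ltn_eqF.
have leT_tr : transitive leT by move=> A B D; apply: leq_trans.
have leT_refl : reflexive leT by move=> A; apply: leqnn.
by apply: (sorted_leq_nth leT_tr leT_refl set0 s_sorted); rewrite ?inE ?sz // ltnW.
Qed.

(** As [v] is comparable with [x], a [v] inside [u] either contains [x], and then the class of [u]
    forces u = x, or lies in [x] and thus properly below [y], which the class of [v] forbids. *)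
Lemma cls_ordered F C (x y u v : {set T}) : x \in C -> y \in C -> x \proper y ->
  u \in cls F comparable_sets C x -> v \in cls F comparable_sets C y ->
  comparable_sets u v -> u \subset v.
Proof.
move=> xC yC xy /(clsP F comparable_sets _ xC)[_ _ xu].
move=> /(clsP F comparable_sets _ yC)[_ Hv yv] /andP[_ /orP[//|vu]].
have /(Hv x xC)/andP[_ /orP[xv|vx]] : x != y.
  by apply: contraTneq xy => ->; rewrite properxx.
  move: xu; rewrite /comparable_sets (subset_trans xv vu) /= andbT negbK.
  by move=> /eqP <-.
move: yv; rewrite /comparable_sets (subset_trans vx (proper_sub xy)) orbT andbT negbK.
by move=> /eqP yv; move: xy; rewrite properE yv vx andbF.
Qed.

End Comparability.

Section EdgeCount.
Variables (R : realFieldType) (V : finType) (F : {set V}) (e : rel V).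
Variables (k : nat) (G : 'I_k -> {set V}).
Hypothesis k_gt0 : (0 < k)%N.
Hypothesis GF : forall i, G i \subset F.
Hypothesis G_disj : forall i j, i != j -> [disjoint G i & G j].
Local Notation m := (#|F|%:R : R).
Local Notation s i := (#|G i|%:R : R).

Definition nonadj i j := (\sum_(u in G i) \sum_(v in G j) ~~ e u v)%N.
Definition adj i j := (\sum_(u in G i) \sum_(v in G j) e u v)%N.

Lemma adjD i j : (adj i j + nonadj i j = #|G i| * #|G j|)%N.
Proof.
rewrite -big_split /= -sum_nat_const; apply: eq_bigr => u _.
by rewrite -big_split /= -sum1_card; apply: eq_bigr => v _; case: (e u v).
Qed.

Lemma sum_parts (f : V -> nat) : (\sum_(u in F) f u =
  \sum_(u in F :\: \bigcup_i G i) f u + \sum_i \sum_(u in G i) f u)%N.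
Proof.
rewrite (big_setID (\bigcup_i G i)) /= addnC; congr (_ + _)%N.
rewrite (setIidPr _); first by rewrite partition_disjoint_bigcup.
by apply/bigcupsP => i _.
Qed.

Lemma card_parts : (#|F| = #|F :\: \bigcup_i G i| + \sum_i #|G i|)%N.
Proof.
rewrite -sum1_card sum_parts sum1_card; congr (_ + _)%N.
by apply: eq_bigr => i _; rewrite sum1_card.
Qed.

Lemma edges_le : (\sum_(u in F) \sum_(v in F) e u v <=
  #|F :\: \bigcup_i G i| * #|F| +
  (\sum_i #|G i|) * #|F :\: \bigcup_i G i| + \sum_i \sum_j adj i j)%N.
Proof.
have le_card (A : {set V}) u : (\sum_(v in A) e u v <= #|A|)%N.
  by rewrite -sum1_card; apply: leq_sum => v _; case: (e u v).
rewrite sum_parts -addnA leq_add //.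
  by rewrite -sum_nat_const; apply: leq_sum.
rewrite big_distrl -big_split /=; apply: leq_sum => i _.
under eq_bigr do rewrite sum_parts.
rewrite big_split /= leq_add //.
  by rewrite -sum_nat_const; apply: leq_sum.
by rewrite exchange_big.
Qed.

(** With S the total size of the layers, the ordered edges across layers number S^2 - sum s_i^2
    minus the missing ones, and sum s_i^2 is S^2/k plus the variance. The edge count is so close to
    Turan's (1 - 1/k) m^2 that missing pairs and variance share a slack of 4 theta m^2. *)
Lemma balanced (z theta eta : R) :
  0 < m -> (1 - z) * m ^+ 2 <= (\sum_(u in F) \sum_(v in F) e u v)%:R ->
  z * k%:R <= 1 + eta -> 0 <= eta -> eta <= theta -> (1 < k)%N ->
  (m - (\sum_i #|G i|)%:R) * m + (\sum_i adj i i)%:R <= theta * m ^+ 2 ->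
  (\sum_i \sum_(j | j != i) nonadj i j)%:R +
    \sum_i (s i - (\sum_j #|G j|)%:R / k%:R) ^+ 2 <= 4 * theta * m ^+ 2.
Proof.
move=> m0 edges zk eta0 eta_th k1 parts.
set S := (\sum_j #|G j|)%N in parts *; set I := (\sum_i adj i i)%N in parts.
set L := (\sum_i _)%N.
have k0 : 2 <= k%:R :> R by rewrite ler_nat.
set c := #|F :\: \bigcup_i G i|; have mE : m = c%:R + S%:R.
  by rewrite -natrD -card_parts.
have sq : \sum_i (s i - S%:R / k%:R) ^+ 2 = \sum_i s i ^+ 2 - S%:R ^+ 2 / k%:R.
  set y := S%:R / k%:R.
  rewrite (eq_bigr (fun i => s i ^+ 2 - 2 * y * s i + y ^+ 2)); last by move=> i _; ring.
  rewrite big_split sumrB /= sumr_const card_ord -[_ *+ k]mulr_natl -mulr_sumr.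
  by rewrite -natr_sum -/S /y; field; lra.
have adj_row i : (\sum_j adj i j + \sum_(j | j != i) nonadj i j + #|G i| ^ 2 =
    adj i i + \sum_j #|G i| * #|G j|)%N.
  have rest : (\sum_(j | j != i) #|G i| * #|G j| =
      \sum_(j | j != i) adj i j + \sum_(j | j != i) nonadj i j)%N.
    by rewrite -big_split; apply: eq_bigr => j _; rewrite -adjD.
  by rewrite (bigD1 i) //= [in RHS](bigD1 i) //= rest mulnn; ring.
have adjE : (\sum_i \sum_j adj i j + L + \sum_i #|G i| ^ 2 = I + S ^ 2)%N.
  by rewrite -mulnn big_distrlr -!big_split; apply: eq_bigr => i _; apply: adj_row.
have sq_cast : \sum_i s i ^+ 2 = (\sum_i #|G i| ^ 2)%:R :> R.
  by rewrite natr_sum; apply: eq_bigr => i _; rewrite natrX.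
have := edges_le; rewrite -/S -/c; move: (congr1 (fun x => x%:R : R) adjE).
rewrite !natrD natrX -sq_cast => adjR; rewrite -(ler_nat R) !natrD !natrM => edgeR.
rewrite sq -[_ / k%:R]mulrC.
have c0 : 0 <= c%:R :> R by [].
have S0 : 0 <= S%:R :> R by [].
have I0 : 0 <= I%:R :> R by [].
have k_inv : 0 < k%:R^-1 :> R by rewrite invr_gt0; lra.
have k_inv2 : k%:R^-1 <= 2^-1 :> R by rewrite lef_pV2 ?posrE; lra.
have {}zk : z <= (1 + eta) * k%:R^-1 by rewrite ler_pdivlMr; lra.
have zm := ler_wpM2r (sqr_ge0 m) zk.
have key : k%:R^-1 * ((1 + eta) * m ^+ 2 - S%:R ^+ 2) + I%:R <= 4 * theta * m ^+ 2.
  have cm : c%:R * m + I%:R <= theta * m ^+ 2 by move: parts; rewrite mE; lra.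
  have bound : (1 + eta) * m ^+ 2 - S%:R ^+ 2 <= theta * m ^+ 2 + 2 * (c%:R * m).
    have := ler_wpM2r (sqr_ge0 m) eta_th.
    have := mulr_ge0 c0 c0; rewrite mE; lra.
  have pos : 0 <= theta * m ^+ 2 + 2 * (c%:R * m).
    by rewrite addr_ge0 // !mulr_ge0 ?sqr_ge0 ?ler0n //; lra.
  have := ler_wpM2l (ltW k_inv) bound; have := ler_wpM2r pos k_inv2.
  have := mulr_ge0 (le_trans eta0 eta_th) (sqr_ge0 m); lra.
move: edges edgeR adjR key zm; rewrite mE; lra.
Qed.

End EdgeCount.

(** That slack is at most (tau m)^2, so each layer deviates from the mean by at most tau m. Indexing
    the classes along the chain of clique members turns adjacency across layers into inclusion by
    [cls_ordered]. *)
Lemma layers (R : rcfType) (T : finType) (F : {set {set T}}) (r : nat)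
    (z eta theta tau : R) :
  0 <= z -> 0 <= eta -> 0 < #|F|%:R :> R ->
  (1 - z) * #|F|%:R ^+ 2 <= 2 * #|cliques F (@comparable_sets T) 2|%:R ->
  z * r.+2%:R <= 1 + eta -> 2 * r.+1%:R * eta <= theta -> eta <= theta ->
  theta <= 1 -> 4 * theta <= tau ^+ 2 -> 0 <= tau ->
  4 * r.+3%:R ^+ 2 * (2 * r.+2%:R ^+ 2) ^+ r.+2 * #|cliques F (@comparable_sets T) r.+3|%:R
    <= theta * #|F|%:R ^+ r.+3 ->
  exists G : 'I_r.+2 -> {set {set T}},
    [/\ forall i j, i != j -> [disjoint G i & G j],
        forall i, G i \subset F,
        (1 - theta) * #|F|%:R <= (\sum_i #|G i|)%:R,
        forall i, (1 - theta - r.+2%:R * tau) * #|F|%:R <= r.+2%:R * #|G i|%:R &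
        forall i j : 'I_r.+2, (i < j)%N -> #|missing G i j|%:R <= tau ^+ 2 * #|F|%:R ^+ 2].
Proof.
move=> z0 eta0 m0 edges zk eta_r eta_th th1 th_tau tau0 few.
have [C Ck partsC] :=
  good_clique (@comparable_sets_sym T) (@comparable_sets_irr T) z0 eta0 m0 edges zk eta_r th1 few.
have [c [c_inj C_eq c_mono]] := clique_chain Ck.
have cC i : c i \in C by rewrite C_eq imset_f.
pose G i := cls F (@comparable_sets T) C (c i).
have sumC (f : {set T} -> nat) : (\sum_(x in C) f x = \sum_i f (c i))%N.
  by rewrite C_eq big_imset //= => i j _ _ /c_inj.
rewrite !sumC in partsC.
have G_disj i j : i != j -> [disjoint G i & G j].
  move=> ij; apply/pred0P => A /=; apply/negP => /andP[Ai Aj].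
  have /c_inj eq_ij := cls_inj (cC i) (cC j) Ai Aj.
  by rewrite eq_ij eqxx in ij.
have GF i : G i \subset F by apply/subsetP=> A /(clsP F (@comparable_sets T) _ (cC i))[].
set m := #|F|%:R : R in m0 edges partsC few *.
have S_ge : (1 - theta) * m <= (\sum_i #|G i|)%:R.
  rewrite -(ler_pM2r m0); move: partsC; rewrite -/m.
  by have := ler0n R (\sum_i inner F (@comparable_sets T) C (c i)); lra.
have edges' : (1 - z) * m ^+ 2 <= (\sum_(u in F) \sum_(v in F) comparable_sets u v)%:R.
  by rewrite (sum_edges _ (@comparable_sets_sym T) (@comparable_sets_irr T)) natrM.
have bal := balanced GF G_disj m0 edges' zk eta0 eta_th (ltn0Sn r) partsC.
rewrite -/m in bal.
set Q := \sum_i (_ - _) ^+ 2 in bal; have Q0 : 0 <= Q.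
  by apply: sumr_ge0 => i _; apply: sqr_ge0.
have tau_m : 4 * theta * m ^+ 2 <= tau ^+ 2 * m ^+ 2 by rewrite ler_wpM2r ?sqr_ge0.
exists G; split => // [i|i j ij].
  set y := (\sum_j #|G j|)%:R / r.+2%:R in Q Q0 bal.
  have dev : (#|G i|%:R - y) ^+ 2 <= (tau * m) ^+ 2.
    rewrite exprMn; apply: le_trans tau_m; apply: le_trans bal.
    apply: (@le_trans _ _ Q); last by rewrite lerDr.
    by rewrite /Q (bigD1 i) //= lerDl sumr_ge0 // => j _; apply: sqr_ge0.
  have {}dev : `|#|G i|%:R - y| <= tau * m.
    by rewrite -(ler_pXn2r (ltn0Sn 1)) ?nnegrE ?normr_ge0 ?mulr_ge0 ?(ltW m0) // -normrX
      ger0_norm ?sqr_ge0.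
  have k0 : 0 < r.+2%:R :> R by rewrite ltr0n.
  have y_eq : r.+2%:R * y = (\sum_j #|G j|)%:R by rewrite mulrC divfK // gt_eqF.
  move: dev; rewrite ler_norml => /andP[dev _].
  have := ler_wpM2l (ltW k0) dev; move: S_ge; rewrite -y_eq; lra.
have ne : j != i by apply: contraTneq ij => ->; rewrite ltnn.
apply: le_trans tau_m; apply: le_trans (le_trans _ bal); last first.
  exact: lexx.
apply: (@le_trans _ _ (\sum_i \sum_(j | j != i) nonadj (@comparable_sets T) G i j)%:R);
  last by rewrite lerDl.
rewrite ler_nat card_missing; apply: (@leq_trans (nonadj (@comparable_sets T) G i j)); last first.
  by rewrite (bigD1 i) //= (bigD1 j) //= -addnA leq_addr.
rewrite leq_sum // => A Ai; rewrite leq_sum // => B Bj.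
have [cAB|] := boolP (comparable_sets A B); last by rewrite leq_b1.
by rewrite (cls_ordered (cC i) (cC j) (c_mono i j ij) Ai Bj cAB).
Qed.

(** * Parameters and assembly of the tower *)

Lemma tower_cover (R : rcfType) (T : finType) (F : {set {set T}}) (r : nat)
    (eps tau theta eta b : R) (k := r.+2%:R : R) (m := #|F|%:R : R) :
  0 < tau -> 32 * k ^+ 2 * tau <= gain r.+2 R -> 3 * k * tau <= eps ->
  theta = tau ^+ 2 / 4 -> eta = theta / (4 * k) ->
  0 < b -> b ^+ r.+2 = 2 ^+ #|T| -> (1 - eta) * k * b <= m -> k <= eta * m ->
  (1 - (1 + eta) / k) * 'C(#|F|, 2)%:R <= #|cliques F (@comparable_sets T) 2|%:R ->
  4 * r.+3%:R ^+ 2 * (2 * k ^+ 2) ^+ r.+2 * #|cliques F (@comparable_sets T) r.+3|%:R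
    <= theta * m ^+ r.+3 ->
  exists X : nat -> {set T},
    [/\ X 0%N = set0, X r.+2 = setT, forall i, (i < r.+2)%N -> X i \subset X i.+1,
        forall i, (i < r.+2)%N -> (r.+2 * (#|X i.+1| - #|X i|) = #|T|)%N &
        #|F :\: \bigcup_(i < r.+2) [set S : {set T} | (X i \subset S) && (S \subset X i.+1)]|%:R
          <= eps * m].
Proof.
move=> tau0 tau_gain tau_eps theta_eq eta_eq b0 b_eq m_ge m_large edges few.
have k2 : 2 <= k by rewrite ler_nat.
have k0 : 0 < k by lra.
have gain1 := gain_le1 r.+2 R.
have tauk2 : k ^+ 2 * tau <= 1 / 32 by lra.
have tauk : k * tau <= 1 / 64.
  by have := mulr_ge0 (ltW tau0) (ltW k0); nra.
have tau_le : tau <= 1 / 128 by nra.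
have theta0 : 0 < theta by rewrite theta_eq divr_gt0 ?exprn_gt0.
have theta_tau : theta <= tau / 4 by rewrite theta_eq; nra.
have eta_k : 4 * k * eta = theta by rewrite eta_eq; field; lra.
have eta0 : 0 < eta by rewrite eta_eq divr_gt0 // mulr_gt0.
have eta_le : 8 * eta <= theta by nra.
have m0 : 0 < m by have := ler0n R #|F|; rewrite -/m le_eqVlt => /orP[/eqP m_eq|//]; nra.
have m1 : 1 <= m by rewrite /m ler1n -(ltr_nat R).
(* The term 1/m corrects for m^2 - m being twice the number of pairs. As k <= eta m it costs one
   more [eta], whence the [2 * eta] passed to [layers]. *)
pose z := (1 + eta) / k + m^-1.
have m_inv : m * m^-1 = 1 by rewrite divff // gt_eqF.
have z0 : 0 <= z by rewrite addr_ge0 ?invr_ge0 ?divr_ge0 //; lra.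
have zk : z * k <= 1 + 2 * eta.
  have -> : z * k = 1 + eta + k / m by rewrite /z mulrDl divfK ?gt_eqF // [m^-1 * k]mulrC.
  have : k / m <= eta by rewrite ler_pdivrMr.
  by lra.
have C2 : 2 * 'C(#|F|, 2)%:R = m ^+ 2 - m.
  have : ('C(#|F|, 2) * 2 = #|F| * #|F|.-1)%N.
    by rewrite (bin_ffact #|F| 2) ffactnS ffactn1.
  move=> /(congr1 (fun x => x%:R : R)); rewrite !natrM -subn1 natrB -/m.
    by lra.
  by rewrite -(ler_nat R).
have edges' : (1 - z) * m ^+ 2 <= 2 * #|cliques F (@comparable_sets T) 2|%:R.
  have -> : (1 - z) * m ^+ 2 = (1 - (1 + eta) / k) * m ^+ 2 - m.
    by rewrite /z opprD addrA mulrBl expr2 [m^-1 * _]mulrA mulVf ?mul1r // gt_eqF.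
  have : 0 <= (1 + eta) / k by rewrite divr_ge0 //; lra.
  move: edges; set y := (1 + eta) / k => edges y0.
  have := congr1 (fun t => (1 - y) * t) C2 => /=.
  have := mulr_ge0 y0 (ltW m0); lra.
have r1 : r.+1%:R = k - 1 by rewrite -[r.+1%:R](addrK 1) natr1.
have eta_r : 2 * r.+1%:R * (2 * eta) <= theta by rewrite r1; nra.
have [||||G [G_disj GF S_ge G_ge G_miss]] := @layers R T F r z (2 * eta) theta tau
  z0 _ m0 edges' zk eta_r _ _ _ (ltW tau0) few; try by [lra|rewrite theta_eq; lra].
rewrite -/k -/m in S_ge G_ge G_miss.
pose rho := 1 - theta - k * tau.
have rho_ge : 31 / 32 <= rho by rewrite /rho; lra.
have G_half i : m <= 2 * k * #|G i|%:R.
  by have := G_ge i; rewrite -/rho => H; nra.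
(* Here [b] stands for 2^(n/k). The total relative loss x satisfies k x <= 1/8, so by Bernoulli k-th
   powers keep 7/8 of 2^n. *)
have base i : (1 - eta - theta - k * tau) * b <= #|G i|%:R.
  rewrite -(ler_pM2l k0); apply: le_trans (G_ge i); rewrite -/rho.
  have rho_pos : 0 <= rho by lra.
  have h1 := ler_wpM2l rho_pos m_ge.
  have h2 : (1 - eta - theta - k * tau) * (k * b) <= rho * (1 - eta) * (k * b).
    rewrite ler_wpM2r ?mulr_ge0 ?(ltW k0) ?(ltW b0) //.
    have : 0 <= k * tau by rewrite mulr_ge0 ?ltW.
    by move: (ltW eta0) (ltW theta0); rewrite /rho; set q := k * tau; nra.
  lra.
have G_gt0 i : (0 < #|G i|)%N by rewrite -(ltr_nat R); have := G_half i; nra.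
set x := eta + theta + k * tau.
have x_eq : 1 - eta - theta - k * tau = 1 - x by rewrite /x; lra.
have x_ge0 : 0 <= x by rewrite !addr_ge0 ?mulr_ge0 ?ltW.
have x_le1 : x <= 1 by rewrite /x; lra.
have kx : k * x <= 1 / 8.
  have := ler_wpM2l (ltW k0) theta_tau; rewrite /x; lra.
have pow_ge : 7 / 8 * 2 ^+ #|T| <= ((1 - x) * b) ^+ r.+2.
  rewrite exprMn b_eq ler_wpM2r ?exprn_ge0 //.
  by apply: le_trans (bernoulli r.+2 x_ge0 x_le1); rewrite -/k; lra.
have base_ge0 : 0 <= (1 - x) * b by rewrite mulr_ge0 ?subr_ge0 // ltW.
rewrite x_eq in base.
have G_pow i : 7 / 8 * 2 ^+ #|T| <= #|G i|%:R ^+ r.+2 :> R.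
  by apply: le_trans pow_ge _; rewrite lerXn2r ?nnegrE ?base ?ler0n.
have G_prod : 7 / 8 * 2 ^+ #|T| <= (\prod_i #|G i|)%:R :> R.
  apply: le_trans pow_ge _; rewrite natr_prod -[X in _ ^+ X](card_ord r.+2).
  rewrite -prodr_const; apply: ler_prod => i _; rewrite base_ge0 /=; exact: base.
(* Since |G_i| >= m/(2k), the bound tau^2 m^2 on missing pairs is at most 4 k^2 tau^2 |G_i|
   |G_j|. *)
pose del := 4 * k ^+ 2 * tau ^+ 2.
have del0 : 0 <= del by rewrite !mulr_ge0 ?(ltW k0) ?(ltW tau0).
have k2tau0 : 0 <= k ^+ 2 * tau by rewrite mulr_ge0 ?sqr_ge0 ?(ltW tau0).
have del_eq : k ^+ 2 * del = 4 * (k ^+ 2 * tau) ^+ 2 by rewrite /del; ring.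
have del_le : k ^+ 2 * del <= 1 / 8 * (k ^+ 2 * tau).
  by rewrite del_eq expr2; have := ler_wpM2r k2tau0 tauk2; lra.
have gain0 := gain_gt0 r.+2 R.
have del_gain : 7 * k ^+ 2 * del < gain r.+2 R by lra.
have del_small : 64 * k ^+ 2 * del <= 1 by lra.
have G_few (i j : 'I_r.+2) : (i < j)%N ->
    #|missing G i j|%:R <= del * (#|G i| * #|G j|)%:R.
  move=> ij; apply: le_trans (G_miss i j ij) _; rewrite natrM.
  have := ler_pM (ltW m0) (ltW m0) (G_half i) (G_half j).
  by move=> /(ler_wpM2l (sqr_ge0 tau)); rewrite /del; lra.
have dims := level_dim (ltn0Sn r.+1) del0 del_gain del_small G_gt0 G_prod G_pow G_few.
have outside := few_outside (ltn0Sn r.+1) del0 del_gain del_small G_gt0 G_prod G_few.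
have subs := level_sub (ltn0Sn r.+1) del0 del_gain del_small G_gt0 G_prod G_few.
have lev0 := level0 (ltn0Sn r.+1) del0 del_gain del_small G_gt0 G_prod G_few.
exists (level R G); split => //; first exact: levelk.
(* At most theta m sets lie in no layer, and at most 16 k del m <= 2 k tau m lie in a layer but
   outside its cube; together this is within 3 k tau m <= eps m. *)
set Tow := \bigcup_(i < _) _.
have : (#|F :\: Tow| <= #|F :\: \bigcup_i G i| +
  \sum_i #|G i :\: between (G i) (level R G i) (level R G i.+1)|)%N.
  apply: (@leq_trans #|(F :\: \bigcup_i G i) :|:
    \bigcup_i (G i :\: between (G i) (level R G i) (level R G i.+1))|).
    apply/subset_leq_card/subsetP=> A; rewrite in_setD => /andP[nA AF].
    rewrite in_setU in_setD AF andbT.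
    have [/bigcupP[i _ Ai]|//] := boolP (A \in \bigcup_i G i).
    apply/bigcupP; exists i => //; rewrite in_setD Ai andbT inE Ai /=.
    by apply: contraNN nA => A_btw; apply/bigcupP; exists i; rewrite // inE.
  rewrite cardsU; apply: leq_trans (leq_subr _ _) _; rewrite leq_add2l.
  exact: card_bigcup_le.
rewrite -(ler_nat R) natrD natr_sum => /le_trans; apply.
have sum_out : \sum_i #|G i :\: between (G i) (level R G i) (level R G i.+1)|%:R <=
    16 * k * del * m.
  apply: (@le_trans _ _ (\sum_i 16 * k * del * #|G i|%:R)).
    by apply: ler_sum => i _; apply: outside.
  rewrite -mulr_sumr -natr_sum ler_wpM2l ?mulr_ge0 ?(ltW k0) ?(ltW tau0) // /m ler_nat.
  by rewrite (card_parts GF G_disj) leq_addl.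
have rest : #|F :\: \bigcup_i G i|%:R <= theta * m.
  have : m = #|F :\: \bigcup_i G i|%:R + (\sum_i #|G i|)%:R.
    by rewrite -natrD -card_parts.
  by move: S_ge; lra.
apply: le_trans (lerD rest sum_out) _; rewrite -mulrDl ler_wpM2r ?(ltW m0) //.
have : 16 * k * del <= 2 * (k * tau).
  have := ler_wpM2r (mulr_ge0 (ltW k0) (ltW tau0)) tauk2; rewrite /del; lra.
have : tau <= k * tau by nra.
lra.
Qed.

Lemma comparable_pairsE n (F : {set {set 'I_n}}) :
  comparable_pairs F = cliques F (@comparable_sets 'I_n) 2.
Proof.
apply/setP=> P; rewrite inE [RHS]inE; apply/idP/idP.
  case/exists_inP=> A AF /exists_inP[B BF /and3P[AB cAB /eqP ->]].
  rewrite cards2 AB subUset !sub1set AF BF /=; apply/is_cliqueP=> C D.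
  rewrite !inE => /orP[/eqP->|/eqP->] /orP[/eqP->|/eqP->]; rewrite ?eqxx // => ne.
    by rewrite /comparable_sets AB.
  by rewrite /comparable_sets eq_sym AB orbC.
case/and3P=> PF /cards2P[A [B [AB PE]]] /is_cliqueP cl; move: PF cl.
rewrite PE subUset !sub1set => /andP[AF BF] cl.
apply/exists_inP; exists A => //; apply/exists_inP; exists B => //.
have /andP[_ cAB] : comparable_sets A B by apply: cl; rewrite ?inE ?eqxx ?orbT.
by rewrite AB cAB eqxx.
Qed.

Lemma expn_le_bound (N k n m : nat) : (N * k <= n)%N -> (2 ^ n <= m ^ k)%N ->
  (0 < k)%N -> (N <= m)%N.
Proof.
move=> Nk nm k0; rewrite leqNgt; apply/negP => mN.
have : (2 ^ n < 2 ^ (N * k))%N.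
  apply: leq_ltn_trans nm _; rewrite expnM ltn_exp2r //.
  by apply: leq_trans mN _; rewrite ltnW // ltn_expl.
by rewrite ltn_exp2l // ltnNge Nk.
Qed.

(* Imported only here because its set notations hide those of finset. *)
From mathcomp Require Import all_classical all_reals all_analysis.

Theorem theorem1p4 (R : realType) (eps : R) (eps_gt0 : 0 < eps)
    (k : nat) (k_ge2 : (2 <= k)%N) :
  exists2 eta : R, 0 < eta &
    exists N : nat, forall n : nat, (N <= n)%N ->
    forall F : {set {set 'I_n}},
      (1 - eta) * k%:R * 2 `^ (n%:R / k%:R) <= #|F|%:R ->
      (1 - (1 + eta) / k%:R) * 'C(#|F|, 2)%:R <= #|comparable_pairs F|%:R ->
      exists2 T : {set {set 'I_n}}, is_tower k T &
        #|F :\: T|%:R <= eps * #|F|%:R.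
Proof.
case: k k_ge2 => [|[|r]] // _; set k := r.+2.
have k2 : 2 <= k%:R :> R by rewrite ler_nat.
have k0 : 0 < k%:R :> R by rewrite ltr0n.
have gain0 := gain_gt0 k R; have gain1 := gain_le1 k R.
(* The first bound makes the share of missing pairs small against [gain]; the second keeps the
   exceptional sets below eps m. *)
pose tau : R := Num.min (gain k R / (32 * k%:R ^+ 2)) (eps / (3 * k%:R)).
pose theta := tau ^+ 2 / 4; pose eta := theta / (4 * k%:R).
have tau0 : 0 < tau by rewrite lt_min !divr_gt0 ?mulr_gt0 ?exprn_gt0.
have theta0 : 0 < theta by rewrite divr_gt0 ?exprn_gt0.
have eta0 : 0 < eta by rewrite divr_gt0 ?mulr_gt0.
have tau_gain : 32 * k%:R ^+ 2 * tau <= gain k R.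
  by rewrite mulrC -ler_pdivlMr ?ge_min ?lexx // mulr_gt0 // exprn_gt0.
have tau_eps : 3 * k%:R * tau <= eps.
  by rewrite mulrC -ler_pdivlMr ?ge_min ?lexx ?orbT // mulr_gt0.
have tau1 : tau <= 1 by nra.
have eta_half : eta <= 1 / 2.
  rewrite /eta ler_pdivrMr ?mulr_gt0 //.
  by have : theta <= 1 / 4 by [rewrite /theta; nra]; lra.
pose Cst : R := 4 * r.+3%:R ^+ 2 * (2 * k%:R ^+ 2) ^+ k.
(* Large enough that a share 1/M of (k+1)-chains meets the clique bound required by
   [tower_cover]. *)
pose M := (Num.truncn (Cst / theta)).+1.
have [N1 few] := @few_k1_chains k M (ltn0Sn _) (ltn0Sn _).
(* For n >= L k, the bound 2^n <= m^k gives m >= L >= k / eta. *)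
pose L := (Num.truncn (k%:R / eta)).+1.
exists eta => //; exists (maxn N1 (L * k)) => n; rewrite geq_max => /andP[leN1 leL] F.
set b := 2 `^ (n%:R / k%:R); set m : R := #|F|%:R => m_ge edges.
have b0 : 0 < b by rewrite powR_gt0.
have b_eq : b ^+ k = 2 ^+ n.
  rewrite -powR_mulrn ?(ltW b0) // -powRrM divfK ?powR_mulrn //; lra.
(* As (1 - eta) k >= 1, the family has at least 2^(n/k) sets, the size at which long chains become
   rare. *)
have b_le : b <= m.
  apply: le_trans m_ge; rewrite -[X in X <= _]mul1r ler_wpM2r ?(ltW b0) //; nra.
have pow_le : (2 ^ #|'I_n| <= #|F| ^ k)%N.
  rewrite card_ord -(ler_nat R) !natrX -b_eq.
  by apply: lerXn2r; rewrite ?nnegrE ?(ltW b0) ?ler0n.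
have m_large : k%:R <= eta * m.
  rewrite mulrC -ler_pdivrMr //; apply: le_trans (ltW (truncnS_gt _)) _.
  by rewrite ler_nat; apply: expn_le_bound pow_le _ => //; rewrite card_ord.
have few_cliques : Cst * #|cliques F (@comparable_sets 'I_n) k.+1|%:R <= theta * m ^+ k.+1.
  have M_ge : Cst <= theta * M%:R.
    by rewrite mulrC -ler_pdivrMr // ltW // truncnS_gt.
  apply: le_trans (ler_wpM2r (ler0n _ _) M_ge) _.
  rewrite -mulrA ler_wpM2l ?(ltW theta0) // -natrM -natrX ler_nat.
  apply: leq_trans (ltnW (few _ F _ pow_le)); last by rewrite card_ord.
  by rewrite leq_mul2l card_cliques_le orbT.
rewrite comparable_pairsE in edges.
rewrite -[n in 2 ^+ n]card_ord in b_eq.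
have [X [X0 Xk Xsub Xdim cover]] := tower_cover tau0 tau_gain tau_eps (erefl theta)
  (erefl eta) b0 b_eq m_ge m_large edges few_cliques.
exists (\bigcup_(i < k) subcube (X i) (X i.+1))%SET => //.
exists X; split => // i ik; rewrite /subcube_dim.
by have := Xdim i ik; rewrite card_ord.
Qed.
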